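(* Let $G(x,t)=\sum_{n=0}^\infty c_n g_n(x)t^n$ be a two-variable generating function (the coefficients $c_n$ being independent of $x$ and $t$). Let $\delta,\omega>0$ be real, and suppose that $x$ and $t$ are such that the series $G(x,tu^\delta(1-u)^\omega)=\sum_{n=0}^\infty c_n g_n(x)\,t^n u^{\delta n}(1-u)^{\omega n}$ converges uniformly for $u\in(0,1)$. Let $j\ge1$ be an integer, let $\alpha_1,\dots,\alpha_j,x_1,\dots,x_j\in\mathbb{C}$ with $\max\{|x_1|,\dots,|x_j|\}<1$, let $r,s\in\mathbb{C}$ with $\Re(s)>\Re(r)>0$, and let $\lambda\ge0$, $p\in\mathbb{C}$; when $\lambda=0$ assume also $|p|<4$. Then $$\int_0^1 u^{r-1}(1-u)^{s-r-1}\prod_{i=1}^{j}(1-x_iu)^{-\alpha_i}\;G\bigl(x,tu^\delta(1-u)^\omega\bigr)\,E_\lambda[p\,u(1-u)]\,du$$ $$=\sum_{n,m_1,\dots,m_j=0}^\infty c_n g_n(x)\,t^n\,\frac{(\alpha_1)_{m_1}\cdots(\alpha_j)_{m_j}\,x_1^{m_1}\cdots x_j^{m_j}}{m_1!\cdots m_j!}\;{}_3\Psi_2\left[\begin{array}{c}(r+\delta n+m_1+\cdots+m_j,1),(s-r+\omega n,1),(1,1);\\(s+\delta n+\omega n+m_1+\cdots+m_j,2),(1,\lambda);\end{array}\;p\right].$$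
   Context: $(a)_n=\Gamma(a+n)/\Gamma(a)=a(a+1)\cdots(a+n-1)$ (with $(a)_0=1$) is the Pochhammer symbol. The Mittag-Leffler function is $E_\lambda(z)=\sum_{n=0}^\infty \frac{z^n}{\Gamma(\lambda n+1)}$ for $\lambda\ge 0$; for $\lambda=0$ it is $E_0(z)=1/(1-z)$ with $|z|<1$. The (un-normalized) Wright hypergeometric function is $${}_p\Psi_q\left[\begin{array}{c}(a_1,A_1),\ldots,(a_p,A_p);\\(b_1,B_1),\ldots,(b_q,B_q);\end{array}z\right]=\sum_{k=0}^\infty\frac{\prod_{i=1}^p\Gamma(a_i+A_ik)}{\prod_{i=1}^q\Gamma(b_i+B_ik)}\,\frac{z^k}{k!}$$ (a parameter pair $(1,0)$ contributes the factor $1$). Powers $(1-x_iu)^{-\alpha_i}$ are principal values. The multiple sum is understood as an iterated sum, with the sum over $n$ outermost. *)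

(* Defs.v *)
From HB Require Import structures.
From mathcomp Require Import all_boot all_order all_algebra.
From mathcomp Require Import complex.
From mathcomp Require Import all_classical all_reals all_analysis.

Set Implicit Arguments.
Unset Strict Implicit.
Unset Printing Implicit Defensive.

Import Order.TTheory GRing.Theory Num.Theory.
Import numFieldNormedType.Exports.

Local Open Scope classical_set_scope.
Local Open Scope ring_scope.
Local Open Scope complex_scope.

(* The usual topology, uniformity and norm of R[i], as a field over itself. *)
HB.instance Definition _ (R : realType) := GRing.ComAlgebra.copy R[i] R[i]^o.
HB.instance Definition _ (R : realType) := Vector.copy R[i] R[i]^o.
HB.instance Definition _ (R : realType) := NormedModule.copy R[i] R[i]^o.

Section Defs.
Context {R : realType}.
Local Notation C := R[i].
Local Notation mu := (@lebesgue_measure R).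
Implicit Types (z w a : C) (u : R).

Definition cexp z : C :=
  (expR (complex.Re z))%:C * (cos (complex.Im z) +i* sin (complex.Im z)).

(* Principal argument: for z != 0 it lies in ]-pi, pi]. *)
Definition carg z : R :=
  let th := acos (complex.Re z / complex.Re `|z|) in
  if 0 <= complex.Im z then th else - th.

Definition cLog z : C := ln (complex.Re `|z|) +i* carg z.

Definition cpow z a : C := if z == 0 then (a == 0)%:R else cexp (a * cLog z).

Definition cintegrable (D : set R) (f : R -> C) : Prop :=
  mu.-integrable D (fun u => (complex.Re (f u))%:E) /\
  mu.-integrable D (fun u => (complex.Im (f u))%:E).

Definition cintegral (D : set R) (f : R -> C) : C :=
  (\int[mu]_(u in D) complex.Re (f u)) +i* (\int[mu]_(u in D) complex.Im (f u)).

Definition pochhammer a (n : nat) : C := \prod_(i < n) (a + i%:R).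

Definition eulerGamma z : C :=
  cintegral `]0, +oo[ (fun u => cpow u%:C (z - 1) * (expR (- u))%:C).

(* Gamma z = Gamma (z + n) / (z)_n, where n is the least natural number with
   0 < Re (z + n); n = 0 when 0 < Re z.  At a pole (z)_n = 0, so that Gamma z
   is 0 there, which agrees with the convention 1 / Gamma z = 0. *)
Definition Gamma z : C :=
  let n := Num.truncn (1 - complex.Re z) in
  eulerGamma (z + n%:R) / pochhammer z n.

(* For la = 0 this is the geometric series, equal to 1 / (1 - z) if |z| < 1. *)
Definition mittag_leffler (la : R) z : C :=
  limn (series (fun n => z ^+ n / Gamma ((la * n%:R + 1)%:C))).

Definition wright_series (A B : seq (C * R)) z : nat -> C :=
  series (fun k =>
    (\prod_(q <- A) Gamma (q.1 + (q.2 * k%:R)%:C)) /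
    (\prod_(q <- B) Gamma (q.1 + (q.2 * k%:R)%:C)) * (z ^+ k / k`!%:R)).

Definition wright (A B : seq (C * R)) z : C := limn (wright_series A B z).

Definition genfun (c : nat -> C) (g : nat -> C -> C) (x t : C) : C :=
  limn (series (fun n => c n * g n x * t ^+ n)).

(* The iterated series of F over k indices converges to S; the first component
   of the tuple is the index of the outermost sum. *)
Fixpoint iterated_sum (k : nat) : (k.-tuple nat -> C) -> C -> Prop :=
  match k with
  | 0 => fun F S => F [tuple] = S
  | k'.+1 => fun F S => exists2 T : nat -> C,
      (forall n, iterated_sum (fun v : k'.-tuple nat => F [tuple of n :: v]) (T n))
      & series T @ \oo --> S
  end.

End Defs.

(* Main.v *)
Require Import Defs.
From HB Require Import structures.
From mathcomp Require Import all_boot all_order all_algebra.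
From mathcomp Require Import complex.
From mathcomp Require Import all_classical all_reals all_analysis.
From mathcomp Require Import measurable_realfun.
From mathcomp Require Import ring lra.

(** The right-hand side is what one obtains by expanding the integrand into
    series and integrating term by term, in the prescribed order.

    On ]0, 1[ the integrand is the product of the function [h u =
    u ^ (r - 1) (1 - u) ^ (s - r - 1) E_la (p u (1 - u))], which is integrable,
    and of [j + 1] functions each of which is the sum of a uniformly convergent
    series of bounded terms: the generating function, by hypothesis, and the [j]
    binomial series of [(1 - xs i u) ^ (- alpha i)]
    ([binomial_uniform_series]). A uniformly convergent series of bounded
    functions may be integrated termwise against an integrable function
    ([cintegral_uniform_series]), and induction on the number of series gives
    the iterated sum ([iterated_sum_cintegral]). Its general term is a
    constant times the integral of
    [u ^ (a - 1) (1 - u) ^ (b - 1) E_la (p u (1 - u))], where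
    [a = r + delta n + m_1 + ... + m_j] and [b = s - r + omega n]. The
    Mittag-Leffler series converges uniformly too
    ([mittag_leffler_uniform_series]), as [|p u (1 - u)| <= |p| / 4], so one more
    termwise integration reduces everything to the Beta integrals
    [Gamma (a + k) Gamma (b + k) / Gamma (a + b + 2 k)], which are the
    coefficients of the Wright series ([wright_series_cvg]).

    The binomial series is summed by the differential equation satisfied by its
    partial sums along the segment from [0] to [xs i], which gives uniformity on
    the closed interval at once. The evaluation of the Beta integral
    ([Beta_Gamma]) is Fubini for the kernel
    [u ^ (a - 1) (w - u) ^ (b - 1) exp (- w)]. Writing it as a quotient of Gamma
    values requires Gamma to have no zero with positive real part
    ([eulerGamma_neq0]): the Beta identity propagates a zero [z] to all
    [z / 2 ^ n], and the functional equation then contradicts the continuity of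
    Gamma at [1]. *)

Set Implicit Arguments.
Unset Strict Implicit.
Unset Printing Implicit Defensive.

Import Order.TTheory GRing.Theory Num.Theory.
Import numFieldNormedType.Exports.

Local Open Scope classical_set_scope.
Local Open Scope ring_scope.
Local Open Scope complex_scope.
Local Notation normc := Normc.normc.

(** * Complex numbers: components, modulus, limits *)

Section ComplexBasics.
Context {R : realType}.
Implicit Types (z w : R[i]) (u : R).

Lemma Re_mul z w : complex.Re (z * w) =
  complex.Re z * complex.Re w - complex.Im z * complex.Im w.
Proof. by case: z w => [a b] [c d]. Qed.

Lemma Im_mul z w : complex.Im (z * w) =
  complex.Re z * complex.Im w + complex.Im z * complex.Re w.
Proof. by case: z w => [a b] [c d]. Qed.

Lemma Re_add z w : complex.Re (z + w) = complex.Re z + complex.Re w.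
Proof. by case: z w => [a b] [c d]. Qed.

Lemma Im_add z w : complex.Im (z + w) = complex.Im z + complex.Im w.
Proof. by case: z w => [a b] [c d]. Qed.

Lemma Re_opp z : complex.Re (- z) = - complex.Re z. Proof. by case: z. Qed.

Lemma Im_opp z : complex.Im (- z) = - complex.Im z. Proof. by case: z. Qed.

Lemma complex_ext z w : complex.Re z = complex.Re w ->
  complex.Im z = complex.Im w -> z = w.
Proof. by case: z w => [a b] [c d] /= -> ->. Qed.

Lemma natrC n : (n%:R)%:C = n%:R :> R[i].
Proof. by rewrite rmorph_nat. Qed.

(** The norm of [R[i]] takes its values in [R[i]] itself; estimates are made with
    the real number [normc], to which the order tactics apply. *)
Lemma normrC z : `|z| = (normc z)%:C. Proof. by []. Qed.

Lemma Re_norm z : complex.Re `|z| = normc z. Proof. by []. Qed.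

Lemma normc_ge0 z : 0 <= normc z.
Proof. by rewrite -lecR -normrC normr_ge0. Qed.

Lemma normc_sqr z : normc z ^+ 2 = complex.Re z ^+ 2 + complex.Im z ^+ 2.
Proof. by case: z => a b /=; rewrite sqr_sqrtr// addr_ge0// sqr_ge0. Qed.

Lemma normcM z w : normc (z * w) = normc z * normc w.
Proof. exact: Normc.normcM. Qed.

Lemma normcD_le z w : normc (z + w) <= normc z + normc w.
Proof. by rewrite -lecR rmorphD -!normrC ler_normD. Qed.

Lemma normcN z : normc (- z) = normc z.
Proof. by apply: complexI; rewrite -!normrC normrN. Qed.

Lemma distcC z w : normc (z - w) = normc (w - z).
Proof. by rewrite -normcN opprB. Qed.

Lemma normc_Re z : `|complex.Re z| <= normc z.
Proof. by rewrite -lecR -normrC normc_ge_Re. Qed.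

Lemma normc_Im z : `|complex.Im z| <= normc z.
Proof.
rewrite -(@ler_pXn2r _ 2%N) ?nnegrE ?normc_ge0// normc_sqr -normrX ger0_norm ?sqr_ge0//.
by rewrite lerDr sqr_ge0.
Qed.

Lemma normc_le_ReIm z : normc z <= `|complex.Re z| + `|complex.Im z|.
Proof.
rewrite -(@ler_pXn2r _ 2%N) ?nnegrE ?normc_ge0 ?addr_ge0// normc_sqr sqrrD.
by rewrite -!normrX !(ger0_norm (sqr_ge0 _)) [leRHS]addrAC lerDl mulrn_wge0// mulr_ge0.
Qed.

Lemma normc_real u : normc u%:C = `|u|.
Proof. by rewrite /= expr0n addr0 sqrtr_sqr. Qed.

Lemma normcX z n : normc (z ^+ n) = normc z ^+ n.
Proof. by apply: complexI; rewrite -normrC normrX rmorphXn. Qed.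

Lemma normcV z : normc z^-1 = (normc z)^-1.
Proof. by apply: complexI; rewrite -normrC normfV fmorphV. Qed.

Lemma normc_nat n : normc (n%:R : R[i]) = n%:R.
Proof. by rewrite -natrC normc_real normr_nat. Qed.

Lemma normc_sum_le (I : Type) (s : seq I) (P : pred I) (F : I -> R[i]) :
  normc (\sum_(i <- s | P i) F i) <= \sum_(i <- s | P i) normc (F i).
Proof.
elim/big_rec2 : _ => [|i y x _ ih]; first by rewrite (normc_nat 0).
by apply: le_trans (normcD_le _ _) _; rewrite lerD2l.
Qed.

Lemma Re_sum (I : Type) (s : seq I) (P : pred I) (F : I -> R[i]) :
  complex.Re (\sum_(i <- s | P i) F i) = \sum_(i <- s | P i) complex.Re (F i).
Proof. by apply: (big_morph _ Re_add). Qed.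

Lemma Im_sum (I : Type) (s : seq I) (P : pred I) (F : I -> R[i]) :
  complex.Im (\sum_(i <- s | P i) F i) = \sum_(i <- s | P i) complex.Im (F i).
Proof. by apply: (big_morph _ Im_add). Qed.

(** Limits in [R[i]] are tested against positive elements of [R[i]]; these are
    exactly the positive reals. *)
Lemma cvgcP (f : nat -> R[i]) (l : R[i]) :
  (f @ \oo --> l) <->
  (forall e, 0 < e -> \forall n \near \oo, normc (l - f n) < e).
Proof.
split=> [/cvgrPdist_lt fl e e0|fl].
  have /fl : 0 < e%:C :> R[i] by rewrite ltcR.
  by apply: filterS => n; rewrite normrC ltcR.
apply/cvgrPdist_lt => e e0.
have /fl : 0 < complex.Re e by move: e0; rewrite ltcE => /andP[].
apply: filterS => n; rewrite normrC -ltcR.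
by rewrite RRe_real// gtr0_real.
Qed.

Lemma cvgc_Re (f : nat -> R[i]) (l : R[i]) : f @ \oo --> l ->
  (fun n => complex.Re (f n)) @ \oo --> complex.Re l.
Proof.
move=> /cvgcP fl; apply/cvgrPdist_lt => e /fl; apply: filterS => n.
by apply: le_lt_trans; rewrite -Re_opp -Re_add; exact: normc_Re.
Qed.

Lemma cvgc_Im (f : nat -> R[i]) (l : R[i]) : f @ \oo --> l ->
  (fun n => complex.Im (f n)) @ \oo --> complex.Im l.
Proof.
move=> /cvgcP fl; apply/cvgrPdist_lt => e /fl; apply: filterS => n.
by apply: le_lt_trans; rewrite -Im_opp -Im_add; exact: normc_Im.
Qed.

Lemma cvgc_ReIm (f : nat -> R[i]) (l : R[i]) :
  (fun n => complex.Re (f n)) @ \oo --> complex.Re l ->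
  (fun n => complex.Im (f n)) @ \oo --> complex.Im l ->
  f @ \oo --> l.
Proof.
move=> /cvgrPdist_lt fr /cvgrPdist_lt fi; apply/cvgcP => e e0.
have e20 : 0 < e / 2 by rewrite divr_gt0.
near=> n.
apply: le_lt_trans (normc_le_ReIm _) _; rewrite (splitr e) ltrD//.
  by rewrite Re_add Re_opp; near: n; exact: fr.
by rewrite Im_add Im_opp; near: n; exact: fi.
Unshelve. all: by end_near. Qed.

Lemma limc_unique (f : nat -> R[i]) (l : R[i]) : f @ \oo --> l -> limn f = l.
Proof. by move=> fl; apply/cvg_lim => //; exact: norm_hausdorff. Qed.

End ComplexBasics.

(** * Measurability of complex functions *)

Section ComplexMeasurable.
Context {R : realType} d {T : measurableType d}.
Implicit Types (D : set T) (f g : T -> R[i]).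

Definition cmeasurable D f :=
  measurable_fun D (fun u => complex.Re (f u)) /\
  measurable_fun D (fun u => complex.Im (f u)).

Lemma cmeasurable_cst D (z : R[i]) : cmeasurable D (fun=> z).
Proof. by split; exact: measurable_cst. Qed.

Lemma cmeasurable_real D (f : T -> R) :
  measurable_fun D f -> cmeasurable D (fun u => (f u)%:C).
Proof. by move=> mf; split => //=; exact: measurable_cst. Qed.

Lemma cmeasurableD D f g : cmeasurable D f -> cmeasurable D g ->
  cmeasurable D (fun u => f u + g u).
Proof.
move=> [fr fi] [gr gi]; split.
  by under eq_fun do rewrite Re_add; exact: measurable_funD.
by under eq_fun do rewrite Im_add; exact: measurable_funD.
Qed.

Lemma cmeasurableN D f : cmeasurable D f -> cmeasurable D (fun u => - f u).
Proof.
move=> [fr fi]; split.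
  by under eq_fun do rewrite Re_opp; exact: measurableT_comp.
by under eq_fun do rewrite Im_opp; exact: measurableT_comp.
Qed.

Lemma cmeasurableM D f g : cmeasurable D f -> cmeasurable D g ->
  cmeasurable D (fun u => f u * g u).
Proof.
move=> [fr fi] [gr gi]; split.
  under eq_fun do rewrite Re_mul.
  by apply: measurable_funB; exact: measurable_funM.
under eq_fun do rewrite Im_mul.
by apply: measurable_funD; exact: measurable_funM.
Qed.

Lemma cmeasurableX D f n : cmeasurable D f -> cmeasurable D (fun u => f u ^+ n).
Proof.
move=> mf; elim: n => [|n ih]; first exact: (cmeasurable_cst D 1).
rewrite (_ : (fun u => f u ^+ n.+1) = (fun u => f u * f u ^+ n)).
  exact: cmeasurableM.
by apply/funext => u; rewrite exprS.
Qed.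

Lemma cmeasurable_cexp D f : cmeasurable D f -> cmeasurable D (fun u => cexp (f u)).
Proof.
move=> [fr fi]; apply: cmeasurableM.
  by apply: cmeasurable_real; exact: (measurableT_comp (@measurable_expR R)).
split => /=.
  apply: (measurableT_comp _ fi); apply: continuous_measurable_fun.
  exact: continuous_cos.
apply: (measurableT_comp _ fi); apply: continuous_measurable_fun.
exact: continuous_sin.
Qed.

Lemma cmeasurable_cvg D (f_ : nat -> T -> R[i]) f :
  (forall n, cmeasurable D (f_ n)) ->
  (forall u, D u -> (fun n => f_ n u) @ \oo --> f u) -> cmeasurable D f.
Proof.
move=> mf fl; split.
  apply: (@measurable_fun_cvg _ _ _ _ (fun n u => complex.Re (f_ n u))).
    by move=> n; case: (mf n).
  by move=> u /fl /cvgc_Re.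
apply: (@measurable_fun_cvg _ _ _ _ (fun n u => complex.Im (f_ n u))).
  by move=> n; case: (mf n).
by move=> u /fl /cvgc_Im.
Qed.

End ComplexMeasurable.

(** * Termwise integration of uniformly convergent series *)

Section UniformSeries.
Context {R : realType}.
Local Notation mu := (@lebesgue_measure R).
Variable D : set (measurableTypeR R).
Hypothesis mD : measurable D.
Implicit Types (f g h : R -> R[i]).

(** The multipliers that preserve integrability. *)
Definition cbounded_measurable f :=
  cmeasurable D f /\ exists M, forall u, D u -> normc (f u) <= M.

Lemma cbmD f g : cbounded_measurable f -> cbounded_measurable g ->
  cbounded_measurable (fun u => f u + g u).
Proof.
move=> [mf [M fM]] [mg [N gN]]; split; first exact: cmeasurableD.
exists (M + N) => u Du; apply: le_trans (normcD_le _ _) _.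
by apply: lerD; [exact: fM|exact: gN].
Qed.

Lemma cbmN f : cbounded_measurable f -> cbounded_measurable (fun u => - f u).
Proof.
move=> [mf [M fM]]; split; first exact: cmeasurableN.
by exists M => u Du; rewrite normcN fM.
Qed.

Lemma cbmM f g : cbounded_measurable f -> cbounded_measurable g ->
  cbounded_measurable (fun u => f u * g u).
Proof.
move=> [mf [M fM]] [mg [N gN]]; split; first exact: cmeasurableM.
exists (M * N) => u Du; rewrite normcM.
by apply: ler_pM; rewrite ?normc_ge0 ?fM ?gN.
Qed.

Lemma cbm_cst (z : R[i]) : cbounded_measurable (fun=> z).
Proof. by split; [exact: cmeasurable_cst|exists (normc z)]. Qed.

Lemma cbm_sum (f : nat -> R -> R[i]) (n : nat) :
  (forall i, cbounded_measurable (f i)) ->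
  cbounded_measurable (fun u => \sum_(0 <= i < n) f i u).
Proof.
move=> mf; elim: n => [|n ih].
  by under eq_fun do rewrite big_nil; exact: cbm_cst.
by under eq_fun do rewrite big_nat_recr//=; exact: cbmD.
Qed.

Lemma cbm_prod (I : Type) (s : seq I) (f : I -> R -> R[i]) :
  (forall i, cbounded_measurable (f i)) ->
  cbounded_measurable (fun u => \prod_(i <- s) f i u).
Proof.
move=> mf; elim: s => [|i s ih].
  by under eq_fun do rewrite big_nil; exact: cbm_cst.
by under eq_fun do rewrite big_cons; exact: cbmM.
Qed.

Lemma cbm_Re_bounded f : cbounded_measurable f ->
  [bounded complex.Re (f u) | u in D].
Proof.
move=> [_ [M fM]]; exists M; split; first exact: num_real.
move=> N MN u Du /=; apply: le_trans (normc_Re _) _.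
by apply: le_trans (ltW MN); exact: fM.
Qed.

Lemma cbm_Im_bounded f : cbounded_measurable f ->
  [bounded complex.Im (f u) | u in D].
Proof.
move=> [_ [M fM]]; exists M; split; first exact: num_real.
move=> N MN u Du /=; apply: le_trans (normc_Im _) _.
by apply: le_trans (ltW MN); exact: fM.
Qed.

Lemma cintegrableM h f : cintegrable D h -> cbounded_measurable f ->
  cintegrable D (fun u => h u * f u).
Proof.
move=> [hr hi] bf; have [[fr fi] _] := bf.
have bR := cbm_Re_bounded bf; have bI := cbm_Im_bounded bf.
split.
  apply: (eq_integrable mD _ _ _
    (integrableB mD (integrableMl mD hr fr bR) (integrableMl mD hi fi bI))).
  by move=> u _ /=; rewrite Re_mul EFinB !EFinM.
apply: (eq_integrable mD _ _ _
  (integrableD mD (integrableMl mD hr fi bI) (integrableMl mD hi fr bR))).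
by move=> u _ /=; rewrite Im_mul EFinD !EFinM.
Qed.

Lemma cintegralB h f : cintegrable D h -> cintegrable D f ->
  cintegral D (fun u => h u - f u) = cintegral D h - cintegral D f.
Proof.
move=> [hr hi] [fr fi]; apply: complex_ext; rewrite ?Re_add ?Re_opp ?Im_add ?Im_opp /=.
  by rewrite -RintegralB//; apply: eq_Rintegral => u _; rewrite Re_add Re_opp.
by rewrite -RintegralB//; apply: eq_Rintegral => u _; rewrite Im_add Im_opp.
Qed.

Lemma cintegralD h f : cintegrable D h -> cintegrable D f ->
  cintegral D (fun u => h u + f u) = cintegral D h + cintegral D f.
Proof.
move=> [hr hi] [fr fi]; apply: complex_ext; rewrite ?Re_add ?Im_add /=.
  by rewrite -RintegralD//; apply: eq_Rintegral => u _; rewrite Re_add.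
by rewrite -RintegralD//; apply: eq_Rintegral => u _; rewrite Im_add.
Qed.

Lemma cintegralZ (z : R[i]) f : cintegrable D f ->
  cintegral D (fun u => z * f u) = z * cintegral D f.
Proof.
move=> [fr fi]; apply: complex_ext; rewrite ?Re_mul ?Im_mul /=.
  rewrite -!RintegralZl// -RintegralB//.
  - by apply: eq_Rintegral => u _; rewrite Re_mul.
  - exact: (integrableZl mD _ fr).
  - exact: (integrableZl mD _ fi).
rewrite -!RintegralZl// -RintegralD//.
- by apply: eq_Rintegral => u _; rewrite Im_mul.
- exact: (integrableZl mD _ fi).
- exact: (integrableZl mD _ fr).
Qed.

Lemma eq_cintegral f g : (forall u, D u -> f u = g u) ->
  cintegral D f = cintegral D g.
Proof.
by move=> fg; congr (_ +i* _); apply: eq_Rintegral => u /[!inE] /fg ->.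
Qed.

Lemma eq_cintegrable f g : (forall u, D u -> f u = g u) ->
  cintegrable D f -> cintegrable D g.
Proof.
move=> fg [fr fi]; split.
  by apply: (eq_integrable mD _ _ _ fr) => u /[!inE] /fg ->.
by apply: (eq_integrable mD _ _ _ fi) => u /[!inE] /fg ->.
Qed.

Lemma cintegrable_bound f (g : R -> R) : cmeasurable D f ->
  mu.-integrable D (EFin \o g) -> (forall u, D u -> normc (f u) <= g u) ->
  cintegrable D f.
Proof.
move=> [mr mi] ig fg; split.
  apply: (le_integrable mD _ _ ig); first exact/measurable_EFinP.
  move=> u Du /=; rewrite lee_fin (le_trans (normc_Re _))//.
  by rewrite (le_trans (fg _ Du))// ler_norm.
apply: (le_integrable mD _ _ ig); first exact/measurable_EFinP.
move=> u Du /=; rewrite lee_fin (le_trans (normc_Im _))//.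
by rewrite (le_trans (fg _ Du))// ler_norm.
Qed.

(** Equivalent to the integral of the modulus up to a factor [2], but its
    integrability follows directly from that of the two components. *)
Definition l1norm h : R :=
  \int[mu]_(u in D) (`|complex.Re (h u)| + `|complex.Im (h u)|).

Lemma l1norm_ge0 h : 0 <= l1norm h.
Proof. by apply: Rintegral_ge0 => u _; rewrite addr_ge0. Qed.

Lemma normc_cintegral_le h f e : cintegrable D h -> cbounded_measurable f ->
  0 <= e -> (forall u, D u -> normc (f u) <= e) ->
  normc (cintegral D (fun u => h u * f u)) <= e * (2 * l1norm h).
Proof.
move=> ih bf e0 fe; have [ir ii] := cintegrableM ih bf.
have [hr hi] := ih.
have il : mu.-integrable D
    (EFin \o (fun u => `|complex.Re (h u)| + `|complex.Im (h u)|)).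
  have := integrableD mD (integrable_norm hr) (integrable_norm hi).
  by apply: eq_integrable.
have key (g : R -> R) : mu.-integrable D (EFin \o g) ->
    (forall u, D u -> `|g u| <= normc (h u * f u)) ->
    `|\int[mu]_(u in D) g u| <= e * l1norm h.
  move=> ig gh; apply: le_trans (le_normr_Rintegral mD ig) _.
  rewrite -RintegralZl//; apply: le_Rintegral => //.
  - exact: (integrable_norm ig).
  - exact: (integrableZl mD _ il).
  - move=> u Du; apply: le_trans (gh _ Du) _.
    rewrite normcM mulrC ler_pM ?normc_ge0 ?fe//.
    exact: normc_le_ReIm.
apply: le_trans (normc_le_ReIm _) _; rewrite mulrCA mulr2n mulrDl !mul1r.
apply: lerD; apply: key => // u _; first exact: normc_Re.
exact: normc_Im.
Qed.

(** The terms are required to be bounded and measurable, so that the sum is too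
    and both may multiply an integrable function. *)
Definition uniform_series (f : nat -> R -> R[i]) g :=
  (forall n, cbounded_measurable (f n)) /\
  (forall e, 0 < e -> \forall N \near \oo, forall u, D u ->
     normc (g u - \sum_(0 <= n < N) f n u) <= e).

Lemma uniform_series_cvg (f : nat -> R -> R[i]) g u : uniform_series f g ->
  D u -> series (fun n => f n u) @ \oo --> g u.
Proof.
move=> [_ fg] Du; apply/cvgcP => e e0.
have /fg : 0 < e / 2 by rewrite divr_gt0.
apply: filterS => N /(_ u Du) /le_lt_trans; apply.
by rewrite ltr_pdivrMr// ltr_pMr// ltr1n.
Qed.

Lemma uniform_series_cbm (f : nat -> R -> R[i]) g : uniform_series f g ->
  cbounded_measurable g.
Proof.
move=> us; have [bf fg] := us; split.
  apply: (@cmeasurable_cvg _ _ _ _ (fun N u => \sum_(0 <= n < N) f n u)).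
    by move=> N; case: (cbm_sum N bf).
  by move=> u Du; exact: uniform_series_cvg us Du.
have [N _ /(_ N (leqnn N)) gN] := fg 1 ltr01.
have [_ [M fM]] := cbm_sum N bf.
exists (1 + M) => u Du.
rewrite -(subrK (\sum_(0 <= n < N) f n u) (g u)).
by apply: le_trans (normcD_le _ _) _; apply: lerD; [exact: gN|exact: fM].
Qed.

(** The tail of the series is uniformly small and multiplies an integrable
    function, so its integral is small. *)
Lemma cintegral_uniform_series h (f : nat -> R -> R[i]) g :
  cintegrable D h -> uniform_series f g ->
  series (fun n => cintegral D (fun u => h u * f n u)) @ \oo -->
  cintegral D (fun u => h u * g u).
Proof.
move=> ih us; have [bf fg] := us; have bg := uniform_series_cbm us.
have sumE N : series (fun n => cintegral D (fun u => h u * f n u)) N =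
    cintegral D (fun u => h u * \sum_(0 <= n < N) f n u).
  rewrite /series /=; elim: N => [|N ih'].
    rewrite big_nil (@eq_cintegral _ (fun=> 0)); last first.
      by move=> u _; rewrite big_nil mulr0.
    by apply: complex_ext => /=; rewrite Rintegral_cst// mul0r.
  rewrite big_nat_recr//= ih' -cintegralD; first last.
  - exact: cintegrableM.
  - by apply: cintegrableM => //; exact: cbm_sum.
  by apply: eq_cintegral => u _; rewrite big_nat_recr//= mulrDr.
apply/cvgcP => e e0.
set L := 2 * l1norm h + 1.
have L0 : 0 < L by rewrite ltr_wpDl// mulr_ge0// l1norm_ge0.
have /fg : 0 < e / L by rewrite divr_gt0.
apply: filterS => N fN.
rewrite sumE -cintegralB; first last.
- by apply: cintegrableM => //; exact: cbm_sum.
- exact: cintegrableM.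
rewrite (@eq_cintegral _ (fun u => h u * (g u - \sum_(0 <= n < N) f n u))); last first.
  by move=> u _; rewrite mulrBr.
apply: (@le_lt_trans _ _ (e / L * (2 * l1norm h))).
  apply: normc_cintegral_le => //; last by rewrite ltW ?divr_gt0.
  by apply: cbmD => //; apply: cbmN; exact: cbm_sum.
by rewrite mulrAC ltr_pdivrMr// ltr_pM2l// /L ltrDl.
Qed.

(** Induction on the number of series. The outermost series is integrated
    termwise against [h] times the product of the remaining sums; for each of
    its terms the induction hypothesis is applied to [h] times that term, which
    is why [h] is an arbitrary integrable function. *)
Lemma iterated_sum_cintegral k h (f : 'I_k -> nat -> R -> R[i])
    (g : 'I_k -> R -> R[i]) :
  cintegrable D h -> (forall i, uniform_series (f i) (g i)) ->
  iterated_sum (fun v : k.-tuple nat =>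
      cintegral D (fun u => h u * \prod_(i < k) f i (tnth v i) u))
    (cintegral D (fun u => h u * \prod_(i < k) g i u)).
Proof.
elim: k h f g => [|k ih] h f g ih_ us /=.
  by apply: eq_cintegral => u _; rewrite !big_ord0.
have bgk : cbounded_measurable (fun u => \prod_(i < k) g (lift ord0 i) u).
  apply: (@cbm_prod _ _ (fun i : 'I_k => g (lift ord0 i))) => i.
  exact: uniform_series_cbm (us _).
exists (fun n => cintegral D (fun u =>
    h u * f ord0 n u * \prod_(i < k) g (lift ord0 i) u)).
  move=> n.
  have := ih (fun u => h u * f ord0 n u) (fun i => f (lift ord0 i))
     (fun i => g (lift ord0 i)).
  have -> : (fun v : k.-tuple nat => cintegral D (fun u =>
      h u * f ord0 n u * \prod_(i < k) f (lift ord0 i) (tnth v i) u)) =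
    (fun v : k.-tuple nat => cintegral D (fun u =>
      h u * \prod_(i < k.+1) f i (tnth [tuple of n :: v] i) u)).
    apply/funext => v; apply: eq_cintegral => u _.
    rewrite big_ord_recl mulrA; congr (_ * _).
    by apply: eq_bigr => i _; rewrite tnthS.
  apply => //; apply: cintegrableM => //; exact: (us ord0).1.
have := cintegral_uniform_series (cintegrableM ih_ bgk) (us ord0).
have -> : (fun n => cintegral D (fun u =>
      h u * (\prod_(i < k) g (lift ord0 i) u) * f ord0 n u)) =
    (fun n => cintegral D (fun u =>
      h u * f ord0 n u * \prod_(i < k) g (lift ord0 i) u)).
  by apply/funext => n; apply: eq_cintegral => u _; rewrite mulrAC.
have -> // : cintegral D (fun u =>
      h u * (\prod_(i < k) g (lift ord0 i) u) * g ord0 u) =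
    cintegral D (fun u => h u * \prod_(i < k.+1) g i u).
apply: eq_cintegral => u _.
by rewrite big_ord_recl -mulrA; congr (_ * _); rewrite mulrC.
Qed.

End UniformSeries.

(** * Complex powers of positive reals *)

Section ComplexPower.
Context {R : realType}.
Implicit Types (z w a b : R[i]) (u v : R).

Lemma cexpD z w : cexp (z + w) = cexp z * cexp w.
Proof.
rewrite /cexp !Re_add !Im_add expRD cosD sinD.
by apply: complex_ext => /=; rewrite !mul0r !subr0 !addr0; ring.
Qed.

Lemma cexp_real u : cexp u%:C = (expR u)%:C.
Proof. by apply: complex_ext => /=; rewrite /cexp /= cos0 sin0; ring. Qed.

Lemma cexp0 : cexp 0 = 1 :> R[i].
Proof. by rewrite cexp_real expR0. Qed.

Lemma normc_cexp z : normc (cexp z) = expR (complex.Re z).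
Proof.
rewrite /cexp normcM normc_real ger0_norm ?expR_ge0//=.
by rewrite cos2Dsin2 sqrtr1 mulr1.
Qed.

Lemma cLog_real u : 0 < u -> cLog u%:C = (ln u)%:C :> R[i].
Proof.
move=> u0; rewrite /cLog /carg Re_norm normc_real gtr0_norm//=.
by rewrite lexx divff ?gt_eqF// acos1.
Qed.

Lemma cpow_real u a : 0 < u -> cpow u%:C a = cexp (a * (ln u)%:C).
Proof.
move=> u0; rewrite /cpow cLog_real// ifF//.
by apply/eqP => /complexI /eqP; rewrite gt_eqF.
Qed.

Lemma normc_cpow_real u a : 0 < u ->
  normc (cpow u%:C a) = u `^ complex.Re a.
Proof.
move=> u0; rewrite cpow_real// normc_cexp Re_mul /= mulr0 subr0.
by rewrite /powR gt_eqF.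
Qed.

Lemma cpow_realD u a b : 0 < u ->
  cpow u%:C (a + b) = cpow u%:C a * cpow u%:C b.
Proof. by move=> u0; rewrite !cpow_real// mulrDl cexpD. Qed.

Lemma cpow_realM u v a : 0 < u -> 0 < v ->
  cpow (u * v)%:C a = cpow u%:C a * cpow v%:C a.
Proof.
move=> u0 v0; rewrite !cpow_real ?mulr_gt0//.
by rewrite lnM ?posrE// rmorphD mulrDr cexpD.
Qed.

Lemma cpow_real_powR u v : 0 < u -> cpow u%:C v%:C = (u `^ v)%:C.
Proof.
by move=> u0; rewrite cpow_real// -rmorphM cexp_real /powR gt_eqF.
Qed.

Lemma cpow_real_nat u n : 0 < u -> cpow u%:C n%:R = (u ^+ n)%:C.
Proof. by move=> u0; rewrite -natrC cpow_real_powR// powR_mulrn// ltW. Qed.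

Lemma cpow_realB1 u a : 0 < u -> cpow u%:C a = cpow u%:C (a - 1) * u%:C.
Proof.
move=> u0; rewrite -[a in LHS](subrK 1) (cpow_realD (a - 1) 1 u0).
by rewrite (cpow_real_nat 1 u0) expr1.
Qed.

(** Vanishing off the positive axis makes every convolution and change of
    variables below an identity on the whole line, without domain conditions. *)
Definition halfline_pow a u : R[i] := if 0 < u then cpow u%:C (a - 1) else 0.

Lemma halfline_powE a u : halfline_pow a u =
  (\1_(`]0, +oo[%classic : set R) u)%:C * cexp ((a - 1) * (ln u)%:C).
Proof.
rewrite /halfline_pow indicE mem_setE in_itv /= andbT.
by case: ifPn => u0; rewrite ?mul1r ?mul0r// cpow_real.
Qed.

Lemma cmeasurable_halfline_pow a :
  cmeasurable (setT : set (measurableTypeR R)) (halfline_pow a).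
Proof.
rewrite (_ : halfline_pow a = fun u =>
  (\1_(`]0, +oo[%classic : set R) u)%:C * cexp ((a - 1) * (ln u)%:C)).
  apply: cmeasurableM.
    by apply: cmeasurable_real; exact: measurable_indic.
  apply: cmeasurable_cexp; apply: cmeasurableM; first exact: cmeasurable_cst.
  by apply: cmeasurable_real; exact: measurable_ln.
by apply/funext => u; exact: halfline_powE.
Qed.

Lemma halfline_pow_gt0 a u : 0 < u -> halfline_pow a u = cpow u%:C (a - 1).
Proof. by rewrite /halfline_pow => ->. Qed.

Lemma halfline_pow_le0 a u : u <= 0 -> halfline_pow a u = 0.
Proof. by rewrite /halfline_pow ltNge => ->. Qed.

Definition halfline_powR (x u : R) : R := if 0 < u then u `^ (x - 1) else 0.

Lemma normc_halfline_pow a u :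
  normc (halfline_pow a u) = halfline_powR (complex.Re a) u.
Proof.
rewrite /halfline_pow /halfline_powR; case: ifPn => u0.
  by rewrite normc_cpow_real// Re_add Re_opp.
exact: (normc_nat 0).
Qed.

Lemma halfline_powR_ge0 x u : 0 <= halfline_powR x u.
Proof. by rewrite /halfline_powR; case: ifPn => // _; exact: powR_ge0. Qed.

Lemma measurable_halfline_powR x :
  measurable_fun (setT : set (measurableTypeR R)) (halfline_powR x).
Proof.
have [mr _] := cmeasurable_halfline_pow x%:C.
rewrite (_ : halfline_powR x = fun u => complex.Re (halfline_pow x%:C u))//.
apply/funext => u; rewrite /halfline_powR /halfline_pow; case: ifPn => // u0.
have -> : x%:C - 1 = (x - 1)%:C by rewrite rmorphB rmorph1.
by rewrite cpow_real_powR.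
Qed.

End ComplexPower.

(** * Affine changes of variable for the Lebesgue integral *)

Section AffineChange.
Context {R : realType}.
Local Notation mu := (@lebesgue_measure R).

Lemma measurable_affine (k c : R) :
  measurable_fun (setT : set (measurableTypeR R))
    (fun x : measurableTypeR R => k * x + c : measurableTypeR R).
Proof.
apply: measurable_funD; last exact: measurable_cst.
by apply: measurable_funM; [exact: measurable_cst|exact: measurable_id].
Qed.

(** Lebesgue measure is determined by its values on half-open intervals, and
    the preimage of such an interval is again one, shorter by the factor [k]. *)
Lemma lebesgue_measure_affine (k c : R) (k0 : 0 < k) (A : set (measurableTypeR R)) :
  measurable A ->
  mu A = (k%:E * mu ((fun x => (k * x + c)%R) @^-1` A))%E.
Proof.
move=> mA.
pose phi : measurableTypeR R -> measurableTypeR R := fun x => k * x + c.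
have mphi : measurable_fun setT phi by exact: measurable_affine.
pose nu := mscale (NngNum (ltW k0)) (pushforward mu phi).
transitivity (nu mphi A); last by [].
apply: lebesgue_measure_unique => // _ [[a b]] _ <-.
pose J : set (measurableTypeR R) := `](a - c) / k, (b - c) / k]%classic.
transitivity (k%:E * mu J)%E; last first.
  congr (_ * mu _)%E; apply/seteqP; split=> x; rewrite /J /= !in_itv /= /phi;
    by rewrite ltr_pdivrMr// ler_pdivlMr// ltrBlDr lerBrDr mulrC.
rewrite /J /= !lebesgue_measure_itv/= !lte_fin ltr_pM2r ?invr_gt0// ltrD2r.
case: ifPn => _; last by rewrite mule0.
rewrite -EFinM; congr EFin; rewrite -mulrBl mulrC divfK ?gt_eqF//.
by rewrite opprB addrA subrK.
Qed.

Lemma ge0_integral_affine (k c : R) (f : R -> \bar R) : 0 < k ->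
  measurable_fun (setT : set (measurableTypeR R)) f ->
  (forall x, 0 <= f x)%E ->
  (\int[mu]_x f x = k%:E * \int[mu]_x f (k * x + c)%R)%E.
Proof.
move=> k0 mf f0.
pose phi : measurableTypeR R -> measurableTypeR R := fun x => k * x + c.
have mphi : measurable_fun setT phi by exact: measurable_affine.
pose nu := mscale (NngNum (ltW k0)) (pushforward mu phi).
rewrite (@eq_measure_integral _ _ _ _ (nu mphi)); last first.
  by move=> A mA _; exact: lebesgue_measure_affine.
by rewrite /nu ge0_integral_mscale//= ge0_integral_pushforward.
Qed.

(** Both sides are differences of integrals of nonnegative functions, and a
    positive factor distributes even over [+oo - +oo]. *)
Lemma integral_affine (k c : R) (f : R -> \bar R) : 0 < k ->
  measurable_fun (setT : set (measurableTypeR R)) f ->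
  (\int[mu]_x f x = k%:E * \int[mu]_x f (k * x + c)%R)%E.
Proof.
move=> k0 mf; pose h (x : R) : R := k * x + c.
rewrite [X in (k%:E * X)%E](_ : _ = \int[mu]_x (f \o h) x)%E//.
rewrite integralE [in RHS]integralE (funepos_comp f h) (funeneg_comp f h).
rewrite (@ge0_integral_affine k c f^\+%E)//; last exact: measurable_funepos.
rewrite (@ge0_integral_affine k c f^\-%E)//; last exact: measurable_funeneg.
pose p := (\int[mu]_x (f^\+ (k * x + c)%R))%E.
pose n := (\int[mu]_x (f^\- (k * x + c)%R))%E.
change (k%:E * p - k%:E * n = k%:E * (p - n))%E.
have : (0 <= p)%E by apply: integral_ge0.
have : (0 <= n)%E by apply: integral_ge0.
move: p n => [p| |] [n| |] // _ _.
- by rewrite -[LHS]/((k * p - k * n)%:E) -[RHS]/((k * (p - n))%:E) mulrBr.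
- by rewrite -[RHS]/(k%:E * -oo)%E gt0_muley ?gt0_muleNy ?lte_fin.
- by rewrite -[RHS]/(k%:E * +oo)%E gt0_muley ?lte_fin.
- by rewrite -[RHS]/(k%:E * -oo)%E gt0_muley ?gt0_muleNy ?lte_fin.
Qed.

Lemma Rintegral_affine (k c : R) (f : R -> R) : 0 < k ->
  measurable_fun (setT : set (measurableTypeR R)) f ->
  \int[mu]_x f x = k * \int[mu]_x f (k * x + c)%R.
Proof.
move=> k0 mf; rewrite /Rintegral (@integral_affine k c)//; last exact/measurable_EFinP.
case: (integral _ _ _) => [r| |] //=; first by rewrite mulr0 gt0_muley ?lte_fin.
by rewrite mulr0 gt0_muleNy ?lte_fin.
Qed.

Lemma cintegral_affine (k c : R) (f : R -> R[i]) : 0 < k ->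
  cmeasurable (setT : set (measurableTypeR R)) f ->
  cintegral setT f = k%:C * cintegral setT (fun x => f (k * x + c)).
Proof.
move=> k0 [fr fi]; apply: complex_ext.
  by rewrite Re_mul /= mul0r subr0; exact: Rintegral_affine k0 fr.
by rewrite Im_mul /= mul0r addr0; exact: Rintegral_affine k0 fi.
Qed.

End AffineChange.

(** * The Gamma function on the positive axis *)

Section RealGamma.
Context {R : realType}.
Local Notation mu := (@lebesgue_measure R).
Implicit Types x u : R.

Lemma powR_is_derive x u : 0 < u ->
  is_derive u 1 (fun v => v `^ x) (x * u `^ (x - 1)).
Proof.
move=> u0; have uoo : u \in `]0, +oo[%R by rewrite in_itv/= andbT.
apply: DeriveDef; first exact: derivable_powR.
by rewrite -derive1E powR_derive1.
Qed.

Lemma integral_powR_itv x e : 0 < x -> 0 < e -> e < 1 ->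
  (\int[mu]_(u in `[e, 1%R]) (u `^ (x - 1))%:E = (x^-1 * (1 - e `^ x))%:E)%E.
Proof.
move=> x0 e0 e1.
have dF u : 0 < u -> is_derive u 1 (fun v => x^-1 * v `^ x) (u `^ (x - 1)).
  move=> u0; have := is_deriveZ (x^-1) (powR_is_derive x u0).
  by move=> h; apply: (is_derive_eq h); rewrite /GRing.scale /= mulrA mulVf ?mul1r ?gt_eqF.
have cF u : 0 < u -> {for u, continuous (fun v => x^-1 * v `^ x)}.
  by move=> u0; apply/differentiable_continuous/derivable1_diffP; have [] := dF u u0.
rewrite (@continuous_FTC2 _ _ (fun v => x^-1 * v `^ x))//.
- by rewrite powR1 mulr1 -EFinB mulrBr mulr1.
- apply: continuous_in_subspaceT => u; rewrite inE/= in_itv/= => /andP[eu _].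
  have u0 : 0 < u by exact: lt_le_trans eu.
  apply/differentiable_continuous/derivable1_diffP.
  by have [] := powR_is_derive (x - 1) u0.
- split.
  + by move=> u; rewrite in_itv/= => /andP[eu _]; have [] := dF u (lt_trans e0 eu).
  + by apply: cvg_at_right_filter; exact: cF.
  + by apply: cvg_at_left_filter; exact: cF.
- move=> u; rewrite in_itv/= => /andP[eu _]; have u0 := lt_trans e0 eu.
  by rewrite derive1E; have [] := dF u u0.
Qed.

(** The integrals over the intervals [[1 / (n + 2), 1]] stay below [1 / x], and
    they increase to the integral over the half-open unit interval. *)
Lemma integrable_powR01 x : 0 < x ->
  mu.-integrable `]0, 1] (EFin \o (fun u => u `^ (x - 1))).
Proof.
move=> x0; apply/integrableP; split.
  by apply/measurable_EFinP/measurable_funTS; exact: measurable_powR.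
rewrite [ltLHS](_ : _ = \int[mu]_(u in `]0%R, 1%R]) (u `^ (x - 1))%:E)%E; last first.
  by apply: eq_integral => u _ /=; rewrite ger0_norm ?powR_ge0.
pose F (n : nat) : set (measurableTypeR R) := `[n.+2%:R^-1, 1]%classic.
have -> : `]0%R, 1%R]%classic = \bigcup_n F n.
  apply/seteqP; split => u /=; last first.
    move=> [n _]; rewrite /F/= !in_itv/= => /andP[nu ->]; rewrite andbT.
    by apply: lt_le_trans nu; rewrite invr_gt0.
  rewrite in_itv/= => /andP[u0 u1].
  have [n _ nu] := near_infty_natSinv_lt (PosNum u0).
  exists n => //; rewrite /F/= in_itv/= u1 andbT ltW//.
  apply: lt_trans (nu n (leqnn n)); rewrite /= ltf_pV2 ?posrE//.
  by rewrite ltr_nat.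
have mF n : measurable (F n) by exact: measurable_itv.
have h : (\int[mu]_(u in F i) (u `^ (x - 1))%:E @[i --> \oo] -->
    \int[mu]_(u in \bigcup_i F i) (u `^ (x - 1))%:E)%E.
  apply: ge0_nondecreasing_set_cvg_integral => //.
  - apply/nondecreasing_seqP => n; rewrite subsetEset => u.
    rewrite /F/= !in_itv/= => /andP[nu ->]; rewrite andbT.
    by apply: le_trans nu; rewrite lef_pV2 ?posrE// ler_nat.
  - by move=> n; apply/measurable_EFinP/measurable_funTS; exact: measurable_powR.
  - by move=> n u _; rewrite lee_fin powR_ge0.
apply: (@le_lt_trans _ _ (x^-1)%:E); last exact: ltry.
rewrite -(cvg_lim _ h)//; apply: lime_le; first by apply/cvg_ex; eexists; exact: h.
apply: nearW => n; rewrite integral_powR_itv//; last first.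
  by rewrite invf_lt1// ltr1n.
by rewrite lee_fin ler_piMr ?invr_ge0 ?(ltW x0)// gerBl powR_ge0.
Qed.

Definition gamma_density x u : R := halfline_powR x u * expR (- u).

Lemma gamma_density_ge0 x u : 0 <= gamma_density x u.
Proof. by rewrite mulr_ge0 ?halfline_powR_ge0 ?expR_ge0. Qed.

Lemma measurable_gamma_density x :
  measurable_fun (setT : set (measurableTypeR R)) (gamma_density x).
Proof.
apply: measurable_funM; first exact: measurable_halfline_powR.
by apply: measurableT_comp => //; exact: measurable_funN.
Qed.

(** For [u] at least [1] the power is below [u ^ (x + 1)], and the tangent line
    of the logarithm at [2 (x + 1)] bounds [(x + 1) ln u] by [u / 2] plus a
    constant: half of the exponential decay absorbs the power. *)
Lemma gamma_density_tail x u : 0 < x -> 1 <= u ->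
  gamma_density x u <=
  expR ((x + 1) * (ln (2 * (x + 1)) - 1)) * expR (- (2^-1 * u)).
Proof.
move=> x0 u1; have u0 : 0 < u by apply: lt_le_trans u1.
have b0 : 0 < x + 1 by rewrite addr_gt0.
rewrite /gamma_density /halfline_powR u0 -expRD.
have h1 : u `^ (x - 1) <= u `^ (x + 1).
  by apply: ler_powR => //; lra.
apply: (@le_trans _ _ (u `^ (x + 1) * expR (- u))).
  by rewrite ler_wpM2r ?expR_ge0.
rewrite /powR gt_eqF// -expRD ler_expR.
have c0 : 0 < u / (2 * (x + 1)) by rewrite divr_gt0 // mulr_gt0.
(* [1 + ln y <= y] at [y = u / (2 (x + 1))] is the tangent line inequality. *)
have := expR_ge1Dx (ln (u / (2 * (x + 1)))).
rewrite lnK ?posrE// ln_div ?posrE ?mulr_gt0// => h.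
have : (x + 1) * (1 + (ln u - ln (2 * (x + 1)))) <= (x + 1) * (u / (2 * (x + 1))).
  by rewrite ler_pM2l.
have -> : (x + 1) * (u / (2 * (x + 1))) = 2^-1 * u by field; rewrite gt_eqF.
by move=> {}h; lra.
Qed.

Lemma integrable_gamma_density x : 0 < x ->
  mu.-integrable setT (EFin \o gamma_density x).
Proof.
move=> x0; pose C := expR ((x + 1) * (ln (2 * (x + 1)) - 1)).
have i1 : mu.-integrable setT (EFin \o ((fun u => u `^ (x - 1)) \_ `]0, 1])).
  move: (integrable_powR01 x0) => /(integrable_mkcond _ _).1.
  by rewrite restrict_EFin; apply; exact: measurable_itv.
have i2 : mu.-integrable setT (fun u => ((2 * C)%:E *
    (EFin \o exponential_pdf 2^-1) u)%E).
  by apply: integrableZl => //; exact: integrable_exponential_pdf.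
apply: (le_integrable _ _ _ (integrableD _ i1 i2)) => //.
  by apply/measurable_EFinP; exact: measurable_gamma_density.
move=> u _ /=; rewrite lee_fin.
have pdf0 : 0 <= exponential_pdf 2^-1 u by rewrite exponential_pdf_ge0.
have C0 : 0 <= C by exact: expR_ge0.
have r0 : 0 <= ((fun u => u `^ (x - 1)) \_ `]0, 1]) u.
  by rewrite patchE; case: ifPn => // _; exact: powR_ge0.
rewrite !ger0_norm ?gamma_density_ge0 ?addr_ge0// ?mulr_ge0//.
have [u0|u0] := leP u 0.
  by rewrite /gamma_density /halfline_powR ltNge u0 /= mul0r addr_ge0 ?mulr_ge0.
have [u1|u1] := leP u 1.
  rewrite -[leLHS]addr0 lerD// ?mulr_ge0//.
  rewrite patchE ifT; last by rewrite inE/= in_itv/= u0.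
  rewrite /gamma_density /halfline_powR u0 ler_piMr ?powR_ge0//.
  by rewrite -expR0 ler_expR oppr_le0 ltW.
rewrite -[leLHS]add0r lerD//.
apply: le_trans (gamma_density_tail x0 (ltW u1)) _.
rewrite /exponential_pdf patchE ifT; last by rewrite inE/= in_itv/= ltW.
rewrite -/C.
by rewrite (_ : 2 * C * _ = C * expR (- 2^-1 * u)) ?mulNr//; field.
Qed.

Definition real_gamma x : R := \int[mu]_u gamma_density x u.

Lemma real_gammaE x : 0 < x ->
  (\int[mu]_u (gamma_density x u)%:E = (real_gamma x)%:E)%E.
Proof.
move=> x0; rewrite /real_gamma /Rintegral fineK//.
exact: integrable_fin_num (integrable_gamma_density x0).
Qed.

(** Only the mass of [[K, K + 1]] is kept; letting [K] grow, this makes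
    [1 / Gamma] decay faster than any geometric sequence along an arithmetic
    progression. *)
Lemma real_gamma_lower_bound (x K : R) : 0 < x -> 0 < K ->
  K `^ x * expR (- (K + 1)) / (K + 1) <= real_gamma x.
Proof.
move=> x0 K0; rewrite -lee_fin -real_gammaE//.
have K1 : 0 < K + 1 by rewrite addr_gt0.
set c := (leLHS).
pose I : set (measurableTypeR R) := `[K, K + 1]%classic.
have mI : measurable I by exact: measurable_itv.
have -> : c = (c * mu I)%E.
  rewrite lebesgue_measure_itv/= lte_fin ltrDl ltr01 -EFinB addrAC subrr add0r.
  by rewrite mule1.
rewrite -integral_cst//.
apply: (@le_trans _ _ (\int[mu]_(u in I) (gamma_density x u)%:E)%E).
  apply: ge0_le_integral => //.
  - by move=> u _; rewrite /cst /c lee_fin !mulr_ge0 ?powR_ge0 ?expR_ge0 ?invr_ge0 ?ltW.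
  - by apply/measurable_EFinP/measurable_funTS; exact: measurable_gamma_density.
  move=> u; rewrite /I /= in_itv/= => /andP[Ku uK]; rewrite /c lee_fin.
  have u0 : 0 < u by exact: lt_le_trans Ku.
  rewrite /gamma_density /halfline_powR u0 mulrAC.
  apply: ler_pM; rewrite ?mulr_ge0 ?powR_ge0 ?expR_ge0 ?invr_ge0 ?(ltW K1)//.
    (* The exponent [x - 1] may be negative, so [u ^ (x - 1)] is bounded below as
       the quotient [u ^ x / u]. *)
    rewrite powRB ?(gt_eqF u0) ?implybT// powRr1 ?(ltW u0)//.
    apply: ler_pM; rewrite ?powR_ge0 ?invr_ge0 ?(ltW K1)//.
      by apply: (ge0_ler_powR (ltW x0)) => //; rewrite nnegrE ltW.
    by rewrite lef_pV2 ?posrE.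
  by rewrite ler_expR lerN2.
apply: ge0_subset_integral => //.
  by apply/measurable_EFinP; exact: measurable_gamma_density.
by move=> u _; rewrite lee_fin gamma_density_ge0.
Qed.

Lemma real_gamma_gt0 x : 0 < x -> 0 < real_gamma x.
Proof.
move=> x0; apply: lt_le_trans (real_gamma_lower_bound x0 ltr01).
by rewrite !mulr_gt0 ?powR_gt0 ?expR_gt0// invr_gt0 addr_gt0.
Qed.

End RealGamma.

(** * Fubini theorem for complex functions *)

Section ComplexFubini.
Context {R : realType}.
Local Notation mu := (@lebesgue_measure R).
Local Notation T := (measurableTypeR R).

Let integral_fine (f : T -> \bar R) : measurable_fun setT f ->
  {ae mu, forall x, f x \is a fin_num} ->
  (\int[mu]_x (fine (f x))%:E = \int[mu]_x f x)%E.
Proof.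
move=> mf finf; apply: ae_eq_integral => //.
  by apply/measurable_EFinP; exact: measurableT_comp.
by apply: filterS finf => x fx _; rewrite fineK.
Qed.

(** The real-valued inner integrals agree with the extended ones only where
    these are finite, that is almost everywhere. *)
Lemma Rintegral_Fubini (f : T * T -> R) :
  (mu \x mu)%E.-integrable setT (EFin \o f) ->
  \int[mu]_x (\int[mu]_y f (x, y)) = \int[mu]_y (\int[mu]_x f (x, y)).
Proof.
move=> fi; rewrite /Rintegral; congr fine.
rewrite (integral_fine (measurable_fubini_F fi)); last first.
  by apply: filterS (ae_integrable1 fi) => x; exact: integrable_fin_num.
rewrite (integral_fine (measurable_fubini_G fi)); last first.
  by apply: filterS (ae_integrable2 fi) => y; exact: integrable_fin_num.
exact: (Fubini fi).
Qed.

Lemma cintegral_Fubini (F : T * T -> R[i]) (G : T * T -> R) :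
  cmeasurable setT F ->
  (mu \x mu)%E.-integrable setT (EFin \o G) ->
  (forall z, normc (F z) <= G z) ->
  cintegral setT (fun x => cintegral setT (fun y => F (x, y))) =
  cintegral setT (fun y => cintegral setT (fun x => F (x, y))).
Proof.
move=> [mr mi] iG FG; apply: complex_ext => /=.
  apply: (@Rintegral_Fubini (fun z => complex.Re (F z))).
  apply: (le_integrable _ _ _ iG) => //; first exact/measurable_EFinP.
  move=> z _ /=; rewrite lee_fin (le_trans (normc_Re _))//.
  by rewrite (le_trans (FG _))// ler_norm.
apply: (@Rintegral_Fubini (fun z => complex.Im (F z))).
apply: (le_integrable _ _ _ iG) => //; first exact/measurable_EFinP.
move=> z _ /=; rewrite lee_fin (le_trans (normc_Im _))//.
by rewrite (le_trans (FG _))// ler_norm.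
Qed.

End ComplexFubini.

(** * Beta integrals and products of Gamma values *)

Section BetaGamma.
Context {R : realType}.
Local Notation mu := (@lebesgue_measure R).
Local Notation T := (measurableTypeR R).
Implicit Types (a b : R[i]) (x y u w : R).

Lemma cintegral_itv_ohalf a (f : R -> R[i]) :
  cintegral `]0, +oo[ (fun u => cpow u%:C (a - 1) * f u) =
  cintegral setT (fun u => halfline_pow a u * f u).
Proof.
rewrite /cintegral; congr (_ +i* _); rewrite Rintegral_mkcond;
  apply: eq_Rintegral => u _; rewrite patchE; case: ifPn => u0.
- by rewrite halfline_pow_gt0//; move: u0; rewrite inE/= in_itv/= andbT.
- rewrite halfline_pow_le0 ?mul0r//.
  by move: u0; rewrite notin_setE/= in_itv/= andbT => /negP; rewrite -leNgt.
- by rewrite halfline_pow_gt0//; move: u0; rewrite inE/= in_itv/= andbT.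
- rewrite halfline_pow_le0 ?mul0r//.
  by move: u0; rewrite notin_setE/= in_itv/= andbT => /negP; rewrite -leNgt.
Qed.

Lemma eulerGammaE a :
  eulerGamma a = cintegral setT (fun u => halfline_pow a u * (expR (- u))%:C).
Proof. exact: cintegral_itv_ohalf. Qed.

(** On the right half-plane the index [n] in the definition of [Gamma] is [0]. *)
Lemma GammaE a : 0 < complex.Re a -> Gamma a = eulerGamma a.
Proof.
move=> a0; rewrite /Gamma; have -> : Num.truncn (1 - complex.Re a) = 0%N.
  by apply/truncn0Pn; rewrite -ltNge gtrBl.
by rewrite addr0 /pochhammer big_ord0 divr1.
Qed.

Lemma cmeasurable_expRN :
  cmeasurable (setT : set T) (fun u => (expR (- u))%:C).
Proof.
apply: cmeasurable_real; apply: (measurableT_comp (@measurable_expR R)).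
exact: measurable_funN.
Qed.

Lemma cintegrable_gamma a : 0 < complex.Re a ->
  cintegrable setT (fun u => halfline_pow a u * (expR (- u))%:C).
Proof.
move=> a0; apply: (cintegrable_bound _ _ (integrable_gamma_density a0)) => //.
  by apply: cmeasurableM; [exact: cmeasurable_halfline_pow|exact: cmeasurable_expRN].
by move=> u _; rewrite normcM normc_halfline_pow normc_real ger0_norm ?expR_ge0.
Qed.

(** In the variables [u] and [w = u + v] this is the integrand of the product of
    the integrals defining [Gamma a] and [Gamma b]. *)
Definition beta_kernel a b (z : T * T) : R[i] :=
  halfline_pow a z.1 * (halfline_pow b (z.2 - z.1) * (expR (- z.2))%:C).

Definition beta_kernelR x y (z : T * T) : R :=
  halfline_powR x z.1 * (halfline_powR y (z.2 - z.1) * expR (- z.2)).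

Let measurable_snd_sub_fst : measurable_fun setT (fun z : T * T => z.2 - z.1 : T).
Proof. by apply: measurable_funB; [exact: measurable_snd|exact: measurable_fst]. Qed.

Lemma cmeasurable_comp d (U : measurableType d) d' (V : measurableType d')
    (phi : U -> V) (f : V -> R[i]) :
  measurable_fun setT phi -> cmeasurable setT f ->
  cmeasurable setT (fun v => f (phi v)).
Proof.
move=> mphi [mr mi].
by split; [exact: (measurableT_comp mr mphi)|exact: (measurableT_comp mi mphi)].
Qed.

Lemma cmeasurable_beta_kernel a b : cmeasurable setT (beta_kernel a b).
Proof.
apply: cmeasurableM.
  by apply: (cmeasurable_comp _ (cmeasurable_halfline_pow a)); exact: measurable_fst.
apply: cmeasurableM.
  exact: (cmeasurable_comp _ (cmeasurable_halfline_pow b)).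
by apply: (cmeasurable_comp _ cmeasurable_expRN); exact: measurable_snd.
Qed.

Lemma normc_beta_kernel a b z :
  normc (beta_kernel a b z) = beta_kernelR (complex.Re a) (complex.Re b) z.
Proof.
by rewrite !normcM !normc_halfline_pow normc_real (ger0_norm (expR_ge0 _)).
Qed.

Lemma beta_kernelR_ge0 x y z : 0 <= beta_kernelR x y z.
Proof. by rewrite !mulr_ge0 ?halfline_powR_ge0 ?expR_ge0. Qed.

Lemma measurable_beta_kernelR x y : measurable_fun setT (beta_kernelR x y).
Proof.
apply: measurable_funM.
  by apply: (measurableT_comp (measurable_halfline_powR x)); exact: measurable_fst.
apply: measurable_funM.
  exact: (measurableT_comp (measurable_halfline_powR y)).
apply: (measurableT_comp (@measurable_expR R)).
by apply: measurable_funN; exact: measurable_snd.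
Qed.

Lemma cmeasurable_beta_kernel_pair a b (phi psi : T -> T) :
  measurable_fun setT phi -> measurable_fun setT psi ->
  cmeasurable setT (fun u => beta_kernel a b (phi u, psi u)).
Proof.
move=> mphi mpsi.
apply: (@cmeasurable_comp _ _ _ _ (fun u => (phi u, psi u)) (beta_kernel a b)).
  exact: measurable_fun_pair.
exact: cmeasurable_beta_kernel.
Qed.

Lemma measurable_beta_kernelR_pair x y (phi psi : T -> T) :
  measurable_fun setT phi -> measurable_fun setT psi ->
  measurable_fun setT (fun u => beta_kernelR x y (phi u, psi u)).
Proof.
move=> mphi mpsi; apply: (measurableT_comp (measurable_beta_kernelR x y)).
exact: measurable_fun_pair.
Qed.

Lemma integral_beta_kernelR x y u : 0 < y ->
  (\int[mu]_w (beta_kernelR x y (u, w))%:E =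
   (gamma_density x u)%:E * (real_gamma y)%:E)%E.
Proof.
move=> y0; rewrite (@ge0_integral_affine _ 1 u)//; first last.
- by move=> w; rewrite lee_fin beta_kernelR_ge0.
- apply/measurable_EFinP; exact: measurable_beta_kernelR_pair.
rewrite mul1e -(real_gammaE y0) -ge0_integralZl//=.
- apply: eq_integral => w _; rewrite /beta_kernelR /gamma_density /= mul1r addrK.
  by rewrite -EFinM opprD expRD; congr EFin; ring.
- by apply/measurable_EFinP; exact: measurable_gamma_density.
- by move=> w _; rewrite lee_fin gamma_density_ge0.
- by rewrite lee_fin gamma_density_ge0.
Qed.

Lemma integral2_beta_kernelR x y : 0 < x -> 0 < y ->
  (\int[mu]_u \int[mu]_w (beta_kernelR x y (u, w))%:E =
   (real_gamma x * real_gamma y)%:E)%E.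
Proof.
move=> x0 y0; under eq_integral do rewrite integral_beta_kernelR//.
rewrite ge0_integralZr//=.
- by rewrite real_gammaE.
- by apply/measurable_EFinP; exact: measurable_gamma_density.
- by move=> w _; rewrite lee_fin gamma_density_ge0.
- by rewrite lee_fin ltW// real_gamma_gt0.
Qed.

Lemma integrable_beta_kernelR x y : 0 < x -> 0 < y ->
  (mu \x mu)%E.-integrable setT (EFin \o beta_kernelR x y).
Proof.
move=> x0 y0; apply/integrable12ltyP.
  by apply/measurable_EFinP; exact: measurable_beta_kernelR.
rewrite (_ : integral _ _ _ = (real_gamma x * real_gamma y)%:E) ?ltry//.
rewrite -(integral2_beta_kernelR x0 y0); apply: eq_integral => u _.
by apply: eq_integral => w _ /=; rewrite ger0_norm ?beta_kernelR_ge0.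
Qed.

Lemma halfline_powR_scale x w u : 0 < w ->
  halfline_powR x (w * u) = w `^ (x - 1) * halfline_powR x u.
Proof.
move=> w0; rewrite /halfline_powR pmulr_rgt0//; case: ifPn => u0; last by rewrite mulr0.
by rewrite powRM// ltW.
Qed.

Lemma halfline_pow_scale a w u : 0 < w ->
  halfline_pow a (w * u) = cpow w%:C (a - 1) * halfline_pow a u.
Proof.
move=> w0; rewrite /halfline_pow pmulr_rgt0//; case: ifPn => u0; last by rewrite mulr0.
by rewrite cpow_realM.
Qed.

Definition betaR_density x y u : R := halfline_powR x u * halfline_powR y (1 - u).

Lemma measurable_betaR_density x y :
  measurable_fun (setT : set T) (betaR_density x y).
Proof.
apply: measurable_funM; first exact: measurable_halfline_powR.
apply: (measurableT_comp (measurable_halfline_powR y)).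
by apply: measurable_funB; [exact: measurable_cst|exact: measurable_id].
Qed.

Lemma betaR_density_ge0 x y u : 0 <= betaR_density x y u.
Proof. by rewrite mulr_ge0 ?halfline_powR_ge0. Qed.

Lemma integral_beta_kernelR_fst x y w :
  (\int[mu]_u (beta_kernelR x y (u, w))%:E =
   (gamma_density (x + y) w)%:E * \int[mu]_u (betaR_density x y u)%:E)%E.
Proof.
have [w0|w0] := leP w 0.
  rewrite integral0_eq.
    by rewrite /gamma_density /halfline_powR ltNge w0 /= mul0r mul0e.
  move=> u _; congr EFin; rewrite /beta_kernelR /halfline_powR /= subr_gt0.
  have [u0|] := ltP 0 u; last by rewrite mul0r.
  by rewrite ltNge (ltW (le_lt_trans w0 u0))/= mul0r mulr0.
rewrite (@ge0_integral_affine _ w 0)//; first last.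
- by move=> u; rewrite lee_fin beta_kernelR_ge0.
- apply/measurable_EFinP; exact: measurable_beta_kernelR_pair.
rewrite -!ge0_integralZl//=; first last.
- by rewrite lee_fin ltW.
- by move=> u _; rewrite lee_fin beta_kernelR_ge0.
- apply/measurable_EFinP; apply: measurable_beta_kernelR_pair => //.
  exact: measurable_affine.
- by rewrite lee_fin gamma_density_ge0.
- by move=> u _; rewrite lee_fin betaR_density_ge0.
- by apply/measurable_EFinP; exact: measurable_betaR_density.
apply: eq_integral => u _; rewrite -!EFinM; congr EFin.
rewrite /beta_kernelR /gamma_density /betaR_density /= addr0.
rewrite [halfline_powR (x + y) w]/halfline_powR w0.
have -> : w - w * u = w * (1 - u) by ring.
rewrite !halfline_powR_scale//.
have -> : w `^ (x + y - 1) = w * (w `^ (x - 1) * w `^ (y - 1)).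
  have -> : x + y - 1 = 1 + ((x - 1) + (y - 1)) by ring.
  by rewrite !powRD ?(gt_eqF w0) ?implybT// powRr1 ?ltW.
by ring.
Qed.

(** By Tonelli, the real Beta integral times [Gamma (x + y)] is the finite number
    [Gamma x * Gamma y], and [Gamma (x + y)] is positive. *)
Lemma integrable_betaR_density x y : 0 < x -> 0 < y ->
  mu.-integrable setT (EFin \o betaR_density x y).
Proof.
move=> x0 y0; apply/integrableP; split.
  by apply/measurable_EFinP; exact: measurable_betaR_density.
rewrite (_ : integral _ _ _ = \int[mu]_u (betaR_density x y u)%:E)%E; last first.
  by apply: eq_integral => u _ /=; rewrite ger0_norm ?betaR_density_ge0.
have : (\int[mu]_w \int[mu]_u (beta_kernelR x y (u, w))%:E < +oo)%E.
  rewrite -(@fubini_tonelli _ _ _ _ _ mu mu (EFin \o beta_kernelR x y)).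
  - by rewrite [ltLHS]integral2_beta_kernelR// ltry.
  - by apply/measurable_EFinP; exact: measurable_beta_kernelR.
  - by move=> z; rewrite lee_fin beta_kernelR_ge0.
under eq_integral do rewrite integral_beta_kernelR_fst.
rewrite ge0_integralZr//=.
- rewrite real_gammaE ?addr_gt0//.
  case: (integral _ _ _) => // [r _|]; first exact: ltry.
  by rewrite gt0_muley// lte_fin real_gamma_gt0 ?addr_gt0.
- by apply/measurable_EFinP; exact: measurable_gamma_density.
- by move=> w _; rewrite lee_fin gamma_density_ge0.
- by apply: integral_ge0 => u _; rewrite lee_fin betaR_density_ge0.
Qed.

Definition beta_density a b u : R[i] := halfline_pow a u * halfline_pow b (1 - u).

Lemma cintegrable_beta_density a b : 0 < complex.Re a -> 0 < complex.Re b ->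
  cintegrable setT (beta_density a b).
Proof.
move=> a0 b0; apply: (cintegrable_bound _ _ (integrable_betaR_density a0 b0)) => //.
  apply: cmeasurableM; first exact: cmeasurable_halfline_pow.
  apply: (cmeasurable_comp _ (cmeasurable_halfline_pow b)).
  by apply: measurable_funB; [exact: measurable_cst|exact: measurable_id].
by move=> u _; rewrite normcM !normc_halfline_pow.
Qed.

(** Integrating the kernel in either order: the substitution [w = u + v] turns
    the inner integral over [w] into [Gamma b], the substitution [u = w v]
    turns the inner integral over [u] into a power of [w] times the Beta
    integral. *)
Lemma Beta_Gamma a b : 0 < complex.Re a -> 0 < complex.Re b ->
  eulerGamma a * eulerGamma b =
  eulerGamma (a + b) * cintegral setT (beta_density a b).
Proof.
move=> a0 b0.
have H := cintegral_Fubini (cmeasurable_beta_kernel a b)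
  (integrable_beta_kernelR a0 b0).
have /H {}H z : normc (beta_kernel a b z) <=
    beta_kernelR (complex.Re a) (complex.Re b) z by rewrite normc_beta_kernel.
have L u : cintegral setT (fun w => beta_kernel a b (u, w)) =
    eulerGamma b * (halfline_pow a u * (expR (- u))%:C).
  have mk : cmeasurable (setT : set T) (fun w => beta_kernel a b (u, w)).
    exact: (cmeasurable_beta_kernel_pair a b (measurable_cst _) (@measurable_id _ _ _)).
  rewrite (cintegral_affine u ltr01 mk).
  rewrite rmorph1 mul1r eulerGammaE [RHS]mulrC.
  rewrite -(cintegralZ measurableT _ (cintegrable_gamma b0)).
  apply: eq_cintegral => w _; rewrite /beta_kernel /= mul1r addrK opprD expRD rmorphM/=.
  by ring.
have M w : cintegral setT (fun u => beta_kernel a b (u, w)) =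
    cintegral setT (beta_density a b) * (halfline_pow (a + b) w * (expR (- w))%:C).
  have [w0|w0] := leP w 0.
    rewrite (halfline_pow_le0 _ w0) mul0r mulr0.
    rewrite (@eq_cintegral _ _ _ (fun=> 0)); last first.
      move=> u _; rewrite /beta_kernel /=.
      have [u0|u0] := leP u 0; first by rewrite (halfline_pow_le0 a u0) mul0r.
      have wu : w - u <= 0 by rewrite subr_le0; exact: ltW (le_lt_trans w0 u0).
      by rewrite (halfline_pow_le0 b wu) mul0r mulr0.
    by apply: complex_ext; rewrite /= /Rintegral integral0.
  have mk : cmeasurable (setT : set T) (fun u => beta_kernel a b (u, w)).
    exact: (cmeasurable_beta_kernel_pair a b (@measurable_id _ _ _) (measurable_cst _)).
  rewrite (cintegral_affine 0 w0 mk).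
  have E u : beta_kernel a b (w * u + 0, w) =
      (cpow w%:C (a - 1) * cpow w%:C (b - 1) * (expR (- w))%:C) * beta_density a b u.
    rewrite /beta_kernel /beta_density /= addr0.
    have -> : w - w * u = w * (1 - u) by ring.
    rewrite (halfline_pow_scale a u w0) (halfline_pow_scale b (1 - u) w0).
    move: (cpow _ (a - 1)) (cpow _ (b - 1)) (halfline_pow a u).
    by move: (halfline_pow b _) (expR _)%:C => *; ring.
  rewrite (@eq_cintegral _ _ _ _ (fun u _ => E u)).
  rewrite (cintegralZ measurableT _ (cintegrable_beta_density a0 b0)).
  rewrite (halfline_pow_gt0 _ w0).
  have -> : a + b - 1 = 1%:R + ((a - 1) + (b - 1)) by ring.
  rewrite (cpow_realD 1%:R (a - 1 + (b - 1)) w0) (cpow_realD (a - 1) (b - 1) w0).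
  rewrite (cpow_real_nat 1 w0) expr1.
  move: (cpow _ (a - 1)) (cpow _ (b - 1)) (cintegral _ _).
  by move: (expR _)%:C => *; ring.
have ab0 : 0 < complex.Re (a + b) by rewrite Re_add addr_gt0.
rewrite (funext L) (funext M) in H.
rewrite (cintegralZ measurableT _ (cintegrable_gamma a0)) -eulerGammaE in H.
rewrite (cintegralZ measurableT _ (cintegrable_gamma ab0)) -eulerGammaE in H.
by rewrite mulrC H mulrC.
Qed.

End BetaGamma.

(** * Differentiation of complex functions of a real variable *)

Section ComplexDerivative.
Context {R : realType}.
Local Notation mu := (@lebesgue_measure R).
Implicit Types (f g : R -> R[i]) (u : R) (a z w : R[i]).

(** Componentwise, so that the mean value theorem and the fundamental theorem of
    calculus for real functions apply. *)
Definition is_cderive u f z :=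
  is_derive u 1 (fun v => complex.Re (f v)) (complex.Re z) /\
  is_derive u 1 (fun v => complex.Im (f v)) (complex.Im z).

Lemma is_cderive_eq u f z w : is_cderive u f z -> z = w -> is_cderive u f w.
Proof. by move=> fz <-. Qed.

Lemma is_cderive_cst u z : is_cderive u (fun=> z) 0.
Proof. by split; exact: is_derive_cst. Qed.

Lemma is_cderive_real u (h : R -> R) (x : R) :
  is_derive u 1 h x -> is_cderive u (fun v => (h v)%:C) x%:C.
Proof. by move=> hx; split => //=; exact: is_derive_cst. Qed.

Lemma is_cderiveD u f g z w : is_cderive u f z -> is_cderive u g w ->
  is_cderive u (fun v => f v + g v) (z + w).
Proof.
move=> [fr fi] [gr gi]; split.
  by under eq_fun do rewrite Re_add; rewrite Re_add; exact: is_deriveD.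
by under eq_fun do rewrite Im_add; rewrite Im_add; exact: is_deriveD.
Qed.

Lemma is_cderiveM u f g z w : is_cderive u f z -> is_cderive u g w ->
  is_cderive u (fun v => f v * g v) (f u * w + z * g u).
Proof.
move=> [fr fi] [gr gi]; split.
  under eq_fun do rewrite Re_mul.
  apply: (is_derive_eq (is_deriveB (is_deriveM fr gr) (is_deriveM fi gi))).
  by rewrite /GRing.scale /= Re_add !Re_mul; ring.
under eq_fun do rewrite Im_mul.
apply: (is_derive_eq (is_deriveD (is_deriveM fr gi) (is_deriveM fi gr))).
by rewrite /GRing.scale /= Im_add !Im_mul; ring.
Qed.

Lemma is_cderiveZ u f z w : is_cderive u f z ->
  is_cderive u (fun v => w * f v) (w * z).
Proof.
move=> fz; apply: (is_cderive_eq (is_cderiveM (is_cderive_cst u w) fz)).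
by rewrite mul0r addr0.
Qed.

Lemma is_cderive_cexp u f z : is_cderive u f z ->
  is_cderive u (fun v => cexp (f v)) (z * cexp (f u)).
Proof.
move=> [fr fi].
have dE : is_derive u 1 (fun v => expR (complex.Re (f v)))
    (expR (complex.Re (f u)) * complex.Re z).
  exact: is_derive1_comp (is_derive_expR _) fr.
have dC : is_derive u 1 (fun v => cos (complex.Im (f v)))
    (- sin (complex.Im (f u)) * complex.Im z).
  exact: is_derive1_comp (is_derive_cos _) fi.
have dS : is_derive u 1 (fun v => sin (complex.Im (f v)))
    (cos (complex.Im (f u)) * complex.Im z).
  exact: is_derive1_comp (is_derive_sin _) fi.
have dCS : is_cderive u (fun v => cos (complex.Im (f v)) +i* sin (complex.Im (f v)))
   ((- sin (complex.Im (f u)) * complex.Im z) +i* (cos (complex.Im (f u)) * complex.Im z)).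
  by split.
apply: (is_cderive_eq (is_cderiveM (is_cderive_real dE) dCS)).
by rewrite /cexp; apply: complex_ext; rewrite ?Re_add ?Im_add ?Re_mul ?Im_mul /=; ring.
Qed.

Lemma is_cderive_sum u (f : nat -> R -> R[i]) (z : nat -> R[i]) n :
  (forall i, is_cderive u (f i) (z i)) ->
  is_cderive u (fun v => \sum_(0 <= i < n) f i v) (\sum_(0 <= i < n) z i).
Proof.
move=> fz; elim: n => [|n ih].
  by under eq_fun do rewrite big_nil; rewrite big_nil; exact: is_cderive_cst.
under eq_fun do rewrite big_nat_recr//=; rewrite big_nat_recr//=.
exact: is_cderiveD.
Qed.

Lemma is_cderive_cpow_real u a : 0 < u ->
  is_cderive u (fun v => cexp (a * (ln v)%:C)) (a * cpow u%:C (a - 1)).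
Proof.
move=> u0; have du := is_derive1_ln u0.
apply: (is_cderive_eq (is_cderive_cexp (is_cderiveZ a (is_cderive_real du)))).
rewrite -cpow_real// (cpow_realB1 a u0) -mulrA; congr (_ * _).
by rewrite mulrCA -rmorphM mulVf ?mulr1// gt_eqF.
Qed.

Lemma is_cderive_continuous u f z : is_cderive u f z ->
  {for u, continuous (fun v => complex.Re (f v))} /\
  {for u, continuous (fun v => complex.Im (f v))}.
Proof.
move=> [[dr _] [di _]].
by split; apply/differentiable_continuous/derivable1_diffP.
Qed.

Lemma cintegral_FTC (F f : R -> R[i]) (f' : R -> R[i]) (x y : R) : x < y ->
  (forall u, x <= u <= y -> is_cderive u F (f u)) ->
  (forall u, x <= u <= y -> is_cderive u f (f' u)) ->
  cintegral `[x, y] f = F y - F x.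
Proof.
move=> xy dF df.
have xx : x <= x <= y by rewrite lexx ltW.
have yy : x <= y <= y by rewrite lexx ltW.
have key (G g : R -> R) :
    (forall u, x <= u <= y -> is_derive u 1 G (g u)) ->
    (forall u, x <= u <= y -> {for u, continuous g}) ->
    \int[mu]_(u in `[x, y]) g u = G y - G x.
  move=> dG cg; rewrite /Rintegral (@continuous_FTC2 _ _ G)//.
  - apply: continuous_in_subspaceT => u; rewrite inE/= in_itv/=; exact: cg.
  - split.
    + move=> u; rewrite in_itv/= => /andP[xu uy].
      by have [] := dG u; rewrite ?(ltW xu) ?(ltW uy).
    + apply: cvg_at_right_filter.
      by apply/differentiable_continuous/derivable1_diffP; case: (dG x xx).
    + apply: cvg_at_left_filter.
      by apply/differentiable_continuous/derivable1_diffP; case: (dG y yy).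
  - move=> u; rewrite in_itv/= => /andP[xu uy].
    by rewrite derive1E; have [] := dG u; rewrite ?(ltW xu) ?(ltW uy).
apply: complex_ext; rewrite ?Re_add ?Re_opp ?Im_add ?Im_opp /=.
  apply: (key (fun u => complex.Re (F u))) => u xuy; first by case: (dF u xuy).
  by case: (is_cderive_continuous (df u xuy)).
apply: (key (fun u => complex.Im (F u))) => u xuy; first by case: (dF u xuy).
by case: (is_cderive_continuous (df u xuy)).
Qed.

(** The factor [2] is the price of applying the mean value theorem to the two
    components separately. *)
Lemma cderive_dist_le (f f' : R -> R[i]) (M x y : R) : x <= y ->
  (forall u, x <= u <= y -> is_cderive u f (f' u)) ->
  (forall u, x <= u <= y -> normc (f' u) <= M) ->
  normc (f y - f x) <= 2 * (M * (y - x)).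
Proof.
move=> xy df fM; have yx0 : 0 <= y - x by rewrite subr_ge0.
have key (h : R -> R) (dh : R -> R) :
    (forall u, x <= u <= y -> is_derive u 1 h (dh u)) ->
    (forall u, x <= u <= y -> `|dh u| <= M) -> `|h y - h x| <= M * (y - x).
  move=> dhu dM; have [||c] := @MVT_segment _ h dh x y xy.
  - move=> u; rewrite in_itv/= => /andP[xu uy].
    by apply: dhu; rewrite !ltW.
  - apply: continuous_in_subspaceT => u; rewrite inE/= in_itv/= => /dhu[du _].
    exact/differentiable_continuous/derivable1_diffP.
  rewrite in_itv/= => xcy ->; rewrite normrM (ger0_norm yx0).
  by rewrite ler_wpM2r// dM.
apply: le_trans (normc_le_ReIm _) _; rewrite mulr2n mulrDl !mul1r.
apply: lerD; rewrite ?Re_add ?Re_opp ?Im_add ?Im_opp.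
  apply: (key (fun u => complex.Re (f u))
    (fun u => complex.Re (f' u))) => u xuy; first by case: (df u xuy).
  exact: le_trans (normc_Re _) (fM u xuy).
apply: (key (fun u => complex.Im (f u))
  (fun u => complex.Im (f' u))) => u xuy; first by case: (df u xuy).
exact: le_trans (normc_Im _) (fM u xuy).
Qed.

End ComplexDerivative.

(** * Functional equation and zeros of Gamma *)

Section GammaFunctional.
Context {R : realType}.
Local Notation mu := (@lebesgue_measure R).
Local Notation T := (measurableTypeR R).
Implicit Types (a b z : R[i]) (x y u w : R).

Lemma Re_neq0 a : 0 < complex.Re a -> a != 0.
Proof. by move=> a0; apply/eqP => a00; move: a0; rewrite a00 ltxx. Qed.

Lemma eulerGamma_real x : 0 < x -> eulerGamma x%:C = (real_gamma x)%:C :> R[i].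
Proof.
have E u : halfline_pow x%:C u * (expR (- u))%:C = (gamma_density x u)%:C.
  rewrite /gamma_density /halfline_pow /halfline_powR rmorphM.
  case: ifPn => u0 //.
  have -> : x%:C - 1 = (x - 1)%:C by rewrite rmorphB rmorph1.
  by rewrite cpow_real_powR.
move=> x0; rewrite eulerGammaE (eq_cintegral (fun u _ => E u)).
by apply: complex_ext => //=; rewrite /Rintegral integral0.
Qed.

Lemma real_gamma1 : real_gamma 1 = 1 :> R.
Proof.
rewrite -[LHS]/(fine (real_gamma 1)%:E) -real_gammaE//.
rewrite (_ : integral _ _ _ = 1%E)//.
have <- := integral_exponential_pdf (@ltr01 R).
have mE : measurable_fun (setT : set T) (EFin \o (fun u => expR (- u))).
  apply/measurable_EFinP; apply: (measurableT_comp (@measurable_expR R)).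
  exact: measurable_funN.
transitivity (\int[mu]_(u in `]0%R, +oo[) (expR (- u))%:E)%E.
  rewrite [RHS]integral_mkcond; apply: eq_integral => u _.
  rewrite patchE mem_setE in_itv/= andbT /gamma_density /halfline_powR subrr.
  by case: ifPn => _; rewrite ?mul0r// powRr0 mul1r.
rewrite integral_itv_obnd_cbnd; last exact: measurable_funTS.
rewrite integral_mkcond; apply: eq_integral => u _.
rewrite /exponential_pdf !patchE; case: ifPn => // _ /=.
by rewrite mul1r mulN1r.
Qed.

Lemma eulerGamma1 : eulerGamma 1 = 1 :> R[i].
Proof. by rewrite -[1 in LHS]/(1%:C) eulerGamma_real// real_gamma1. Qed.

Lemma halfline_pow1 u : halfline_pow 1 u = (\1_(`]0, +oo[%classic : set R) u)%:C :> R[i].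
Proof. by rewrite halfline_powE subrr mul0r cexp0 mulr1. Qed.

Lemma cintegral_patch (D : set R) (f : R -> R[i]) :
  cintegral setT (f \_ D) = cintegral D f.
Proof.
rewrite /cintegral; congr (_ +i* _); rewrite [RHS]Rintegral_mkcond;
  by apply: eq_Rintegral => u _; rewrite !patchE; case: ifPn.
Qed.

Lemma cintegral_itv_co_cc (f : R -> R[i]) x y : cmeasurable (setT : set T) f ->
  cintegral `[x, y[ f = cintegral `[x, y] f.
Proof.
move=> [mr mi]; rewrite /cintegral /Rintegral; congr (fine _ +i* fine _);
  by apply: integral_itv_bndo_bndc; apply/measurable_EFinP/measurable_funTS.
Qed.

(** The integral of [u ^ (a - 1)] over [0, 1] is computed without an improper
    limit: it scales by [k ^ a] when the interval shrinks to [0, k], and the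
    difference of the two is a proper integral. *)
Lemma cintegral_beta1 a : 0 < complex.Re a ->
  cintegral setT (beta_density a 1) = a^-1.
Proof.
move=> a0; set J := cintegral _ _.
have a00 := Re_neq0 a0.
(* [k] is strictly between [0] and [1], so that [k ^ a] has modulus below [1]. *)
pose k : R := 2^-1; have k0 : 0 < k by rewrite invr_gt0.
have k1 : k < 1 by rewrite invf_lt1// ltr1n.
have iJ : cintegrable setT (beta_density a 1).
  by apply: cintegrable_beta_density.
pose trunc u := halfline_pow a u * halfline_pow 1 (k - u).
have mtrunc : cmeasurable (setT : set T) trunc.
  apply: cmeasurableM; first exact: cmeasurable_halfline_pow.
  apply: (cmeasurable_comp _ (cmeasurable_halfline_pow 1)).
  by apply: measurable_funB; [exact: measurable_cst|exact: measurable_id].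
have scaleJ : cintegral setT trunc = cpow k%:C a * J.
  rewrite (cintegral_affine 0 k0 mtrunc).
  have E u : trunc (k * u + 0) = cpow k%:C (a - 1) * beta_density a 1 u.
    rewrite /trunc addr0 (halfline_pow_scale a u k0) -mulrA; congr (_ * (_ * _)).
    rewrite !halfline_pow1 !indicE !mem_setE !in_itv/= !andbT.
    by rewrite !subr_gt0 gtr_pMr.
  rewrite (eq_cintegral (fun u _ => E u)) (cintegralZ measurableT _ iJ) mulrA.
  by rewrite -/J; congr (_ * _); rewrite (cpow_realB1 a k0) mulrC.
have itrunc : cintegrable setT trunc.
  apply: (cintegrable_bound _ mtrunc (integrable_betaR_density a0 (@ltr01 R))) => //.
  move=> u _; rewrite normcM normc_halfline_pow ler_wpM2l ?halfline_powR_ge0//.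
  rewrite normc_halfline_pow /= /halfline_powR !subrr.
  rewrite !subr_gt0; case: ifPn => uk; case: ifPn => u1; rewrite ?powRr0//.
  by move: u1; rewrite (lt_trans uk k1).
have diffJ : J - cpow k%:C a * J = cintegral `[k, 1%R] (halfline_pow a).
  rewrite -scaleJ -(cintegralB measurableT iJ itrunc).
  have E u : beta_density a 1 u - trunc u = (halfline_pow a \_ `[k, 1%R[) u.
    rewrite patchE mem_setE in_itv/= /beta_density /trunc -mulrBr.
    rewrite !halfline_pow1 !indicE !mem_setE !in_itv/= !andbT !subr_gt0.
    have [ku|uk] := leP k u; last first.
      by rewrite (lt_trans uk k1) subrr mulr0.
    by rewrite subr0; case: (u < 1); rewrite ?mulr0// mulr1.
  rewrite (eq_cintegral (fun u _ => E u)) cintegral_patch.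
  by apply: cintegral_itv_co_cc; exact: cmeasurable_halfline_pow.
have FTC : cintegral `[k, 1%R] (halfline_pow a) = a^-1 * (1 - cpow k%:C a).
  pose F (b : R[i]) u := cexp (b * (ln u)%:C).
  have dF b u : 0 < u -> is_cderive u (F b) (b * F (b - 1) u).
    move=> u0; rewrite /F -(cpow_real (b - 1) u0).
    exact: is_cderive_cpow_real.
  have pos u : k <= u <= 1 -> 0 < u by move=> /andP[ku _]; exact: lt_le_trans ku.
  have E u : (`[k, 1%R]%classic : set R) u -> halfline_pow a u = F (a - 1) u.
    rewrite /= in_itv/= => /pos u0.
    by rewrite (halfline_pow_gt0 a u0) (cpow_real (a - 1) u0).
  rewrite (eq_cintegral E).
  rewrite (@cintegral_FTC _ (fun u => a^-1 * F a u) _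
    (fun u => (a - 1) * F (a - 1 - 1) u) _ _ k1).
  - rewrite /F ln1 mulr0 cexp0 mulrBr -(cpow_real a k0) //.
  - move=> u /pos u0; apply: (is_cderive_eq (is_cderiveZ a^-1 (dF a u u0))).
    by rewrite mulrA mulVf// mul1r.
  - by move=> u /pos u0; exact: dF.
have ka : 1 - cpow k%:C a != 0.
  rewrite subr_eq0; apply/eqP => h.
  have := normc_cpow_real a k0; rewrite -h (normc_nat 1) => /esym/eqP.
  by rewrite powR_eq1 (ltNge k 0) (ltW k0) (lt_eqF k1) (gt_eqF a0).
apply: (mulIf ka); rewrite -FTC -diffJ mulrBr mulr1.
by rewrite [in LHS](mulrC J).
Qed.

(** This is the Beta identity at [b = 1]. *)
Lemma eulerGammaS a : 0 < complex.Re a -> eulerGamma (a + 1) = a * eulerGamma a.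
Proof.
move=> a0; have := @Beta_Gamma R a 1 a0 ltr01.
rewrite eulerGamma1 mulr1 cintegral_beta1// => ->.
by rewrite mulrCA divff ?mulr1// Re_neq0.
Qed.

Lemma eulerGamma_nat n : eulerGamma (1 + n%:R) = n`!%:R :> R[i].
Proof.
elim: n => [|n ih]; first by rewrite addr0 eulerGamma1.
rewrite -[in LHS]natr1 addrA eulerGammaS.
  by rewrite ih factS natrM addrC natr1.
by rewrite Re_add -natrC/= ltr_wpDr.
Qed.

Lemma Re_mul_half z n : complex.Re (z / 2 ^+ n) = complex.Re z / 2 ^+ n /\
  complex.Im (z / 2 ^+ n) = complex.Im z / 2 ^+ n.
Proof.
have -> : (2 ^+ n)^-1 = ((2 ^+ n)^-1)%:C :> R[i].
  by rewrite fmorphV rmorphXn rmorph_nat.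
by rewrite Re_mul Im_mul/= !mulr0 subr0 add0r.
Qed.

Lemma powR_le_1D u x y : 0 < u -> 0 <= y <= x -> u `^ y <= 1 + u `^ x.
Proof.
move=> u0 /andP[y0 yx]; have [u1|u1] := leP u 1.
  rewrite -[leLHS]addr0 lerD ?powR_ge0// -[leRHS](powRr0 u).
  by apply: ger_powR => //; rewrite u0.
rewrite -[leLHS]add0r lerD//; exact: (ler_powR (ltW u1)).
Qed.

(** Dominated convergence: the modulus of [u ^ (z / 2 ^ n)] is a power of [u] with
    exponent between [0] and [Re z], hence at most [1 + u ^ Re z]. *)
Lemma cvg_eulerGamma_halving z : 0 < complex.Re z ->
  (fun n => complex.Re (eulerGamma (z / 2 ^+ n + 1))) @ \oo --> (1 : R).
Proof.
move=> z0; set x := complex.Re z.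
pose f n u := complex.Re (halfline_pow (z / 2 ^+ n + 1) u * (expR (- u))%:C).
have half0 n : 0 <= x / 2 ^+ n by rewrite divr_ge0// ?exprn_ge0// ltW.
have halfx n : x / 2 ^+ n <= x.
  by rewrite ler_pdivrMr ?exprn_gt0// ler_peMr ?(ltW z0)// exprn_ege1// ler1n.
have cvg2 (c : R) : (fun n => c / 2 ^+ n) @ \oo --> (0 : R).
  rewrite -(mulr0 c); apply: cvgMr.
  under eq_fun do rewrite -exprVn.
  by apply: cvg_expr; rewrite ger0_norm ?invr_ge0// invf_lt1// ltr1n.
have Re1 n : complex.Re (z / 2 ^+ n + 1) = x / 2 ^+ n + 1.
  by rewrite Re_add (Re_mul_half z n).1.
have fE n u : 0 < u -> f n u =
    expR (x * ln u / 2 ^+ n) * cos (complex.Im z * ln u / 2 ^+ n) * expR (- u).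
  move=> u0; rewrite /f (halfline_pow_gt0 _ u0) addrK (cpow_real _ u0).
  have [rE iE] := Re_mul_half z n.
  have -> : z / 2 ^+ n * (ln u)%:C =
      (x * ln u / 2 ^+ n) +i* (complex.Im z * ln u / 2 ^+ n).
    apply: complex_ext; first by rewrite Re_mul rE iE /x /=; ring.
    by rewrite Im_mul rE iE /x /=; ring.
  by rewrite /cexp !Re_mul !Im_mul /=; ring.
have f_le0 n u : u <= 0 -> f n u = 0.
  by move=> u0; rewrite /f (halfline_pow_le0 _ u0) mul0r.
have g_le0 y u : u <= 0 -> gamma_density y u = 0.
  by move=> u0; rewrite /gamma_density /halfline_powR ltNge u0 /= mul0r.
have mf n : measurable_fun (setT : set T) (f n).
  by case: (cmeasurableM (cmeasurable_halfline_pow (z / 2 ^+ n + 1)) (@cmeasurable_expRN R)).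
have ptwise u : (fun n => f n u) @ \oo --> gamma_density 1 u.
  have [u0|u0] := leP u 0.
    rewrite g_le0// (_ : (fun n => f n u) = fun=> 0); first exact: cvg_cst.
    by apply/funext => n; exact: f_le0.
  rewrite (_ : (fun n => f n u) = fun n =>
    expR (x * ln u / 2 ^+ n) * cos (complex.Im z * ln u / 2 ^+ n) * expR (- u)); last first.
    by apply/funext => n; exact: fE.
  have e1 : (fun n => expR (x * ln u / 2 ^+ n)) @ \oo --> (1 : R).
    rewrite -[1 in X in _ --> X]expR0.
    exact: (continuous_cvg _ (@continuous_expR R 0) (cvg2 _)).
  have c1 : (fun n => cos (complex.Im z * ln u / 2 ^+ n)) @ \oo --> (1 : R).
    rewrite -[1 in X in _ --> X]cos0.
    exact: (continuous_cvg _ (@continuous_cos R 0) (cvg2 _)).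
  have -> : gamma_density 1 u = 1 * 1 * expR (- u).
    by rewrite /gamma_density /halfline_powR u0 subrr powRr0 mulr1.
  exact: (cvgM (cvgM e1 c1) (cvg_cst (expR (- u)))).
have bound n u : `|f n u| <= gamma_density 1 u + gamma_density (x + 1) u.
  apply: le_trans (normc_Re _) _.
  rewrite normcM normc_halfline_pow normc_real (ger0_norm (expR_ge0 _)) Re1.
  rewrite /gamma_density -mulrDl ler_wpM2r ?expR_ge0// /halfline_powR.
  case: ifPn => u0; last by rewrite addr0.
  by rewrite !addrK subrr powRr0; apply: powR_le_1D; rewrite ?half0 ?halfx.
have ptE : {ae mu, forall u : T, setT u ->
    (fun n => (f n u)%:E) @ \oo --> (gamma_density 1 u)%:E}.
  by apply: aeW => u _; apply: cvg_EFin; [exact: nearW|exact: ptwise].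
have boundE : {ae mu, forall (u : T) n, setT u ->
    (`|(f n u)%:E| <= (gamma_density 1 u + gamma_density (x + 1) u)%:E)%E}.
  by apply: aeW => u n _; rewrite lee_fin bound.
have iE : mu.-integrable (setT : set T)
    (fun u => (gamma_density 1 u + gamma_density (x + 1) u)%:E).
  have := integrableD measurableT (integrable_gamma_density ltr01)
    (integrable_gamma_density (addr_gt0 z0 ltr01)).
  by apply: eq_integrable.
have [_ _ dc] := @dominated_convergence _ T R mu setT measurableT
  (fun n u => (f n u)%:E) (fun u => (gamma_density 1 u)%:E)
  (fun u => (gamma_density 1 u + gamma_density (x + 1) u)%:E)
  (fun n => (measurable_EFinP _ _).2 (mf n))
  ((measurable_EFinP _ _).2 (measurable_gamma_density 1))
  ptE iE boundE.
have d1 : (fun n => \int[mu]_u (f n u)%:E)%E @ \oo --> (1 : R)%:E.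
  by have := dc; rewrite real_gammaE// real_gamma1.
suff -> : (fun n => complex.Re (eulerGamma (z / 2 ^+ n + 1))) =
    fine \o (fun n => \int[mu]_u (f n u)%:E)%E by exact: fine_cvg d1.
by apply/funext => n; rewrite eulerGammaE.
Qed.


(** A zero [z] would propagate to [z / 2], since [Gamma (z / 2) ^ 2] is
    [Gamma z] times a Beta integral, hence to all [z / 2 ^ n], and then to
    [z / 2 ^ n + 1] by the functional equation; but these points tend to [1],
    where Gamma is [1]. *)
Lemma eulerGamma_neq0 z : 0 < complex.Re z -> eulerGamma z != 0.
Proof.
move=> z0; apply/eqP => Gz.
have Re2_gt0 n : 0 < complex.Re (z / 2 ^+ n) by rewrite (Re_mul_half z n).1 divr_gt0// exprn_gt0.
have G0 n : eulerGamma (z / 2 ^+ n) = 0.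
  elim: n => [|n ih]; first by rewrite expr0 divr1.
  have := Beta_Gamma (Re2_gt0 n.+1) (Re2_gt0 n.+1).
  rewrite (_ : z / 2 ^+ n.+1 + z / 2 ^+ n.+1 = z / 2 ^+ n).
    by rewrite ih mul0r => /eqP; rewrite mulf_eq0 orbb => /eqP.
  by rewrite exprS; field.
have := cvg_eulerGamma_halving z0.
rewrite (_ : (fun n => _) = fun=> 0).
  move=> /(cvg_lim (@Rhausdorff R)); rewrite lim_cst// => /eqP.
  by rewrite eq_sym oner_eq0.
by apply/funext => n; rewrite eulerGammaS// G0 mulr0.
Qed.

End GammaFunctional.

(** * Uniform convergence of the Mittag-Leffler series *)

Section Weierstrass.
Context {R : realType}.
Variable D : set (measurableTypeR R).
Hypothesis mD : measurable D.

Lemma geometric_tail (M q : R) m n : 0 <= q < 1 -> 0 <= M ->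
  \sum_(m <= k < n) M * q ^+ k <= M * q ^+ m / (1 - q).
Proof.
move=> /andP[q0 q1] M0.
have q1' : 0 < 1 - q by rewrite subr_gt0.
rewrite ler_pdivlMr// big_distrl/=.
have [nm|mn] := leqP n m.
  by rewrite big_geq// mulr_ge0// exprn_ge0.
rewrite (telescope_sumr_eq (fun k => - (M * q ^+ k)))//.
  by rewrite opprK addrC gerDl oppr_le0 mulr_ge0// exprn_ge0.
  exact: ltnW.
by move=> k _; rewrite exprS; ring.
Qed.

Lemma geometric_cvg (M q : R) (f : nat -> R[i]) : 0 <= q < 1 ->
  (forall n, normc (f n) <= M * q ^+ n) ->
  series f @ \oo --> limn (series f).
Proof.
move=> /andP[q0 q1] fM.
have cg : cvgn (series (fun n => M * q ^+ n)).
  by apply: is_cvg_geometric_series; rewrite ger0_norm.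
have key (g : nat -> R) : (forall n, `|g n| <= normc (f n)) -> cvgn (series g).
  move=> gf; apply: normed_cvg.
  apply: (series_le_cvg _ _ _ cg) => n /=; first exact: normr_ge0.
    by apply: le_trans (fM n); exact: normc_ge0.
  exact: le_trans (gf n) (fM n).
have cr := key (fun n => complex.Re (f n)) (fun n => normc_Re (f n)).
have ci := key (fun n => complex.Im (f n)) (fun n => normc_Im (f n)).
pose l : R[i] := limn (series (fun n => complex.Re (f n))) +i*
  limn (series (fun n => complex.Im (f n))).
have fl : series f @ \oo --> l.
  apply: cvgc_ReIm => /=.
    by under eq_fun do rewrite /series/= Re_sum; exact: cr.
  by under eq_fun do rewrite /series/= Im_sum; exact: ci.
by rewrite (limc_unique fl).
Qed.

(** Weierstrass test with a geometric majorant. *)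
Lemma geometric_uniform_series (M q : R) (f : nat -> R -> R[i]) :
  0 <= q < 1 -> (forall n, cbounded_measurable D (f n)) ->
  (forall n u, D u -> normc (f n u) <= M * q ^+ n) ->
  uniform_series D f (fun u => limn (series (fun n => f n u))).
Proof.
move=> q01 bf fM; split=> // e e0; have /andP[q0 q1] := q01.
have [M0|M0] := leP 0 M; last first.
  apply: nearW => N u Du; have := fM 0%N u Du; rewrite expr0 mulr1 => /le_lt_trans.
  by move=> /(_ _ M0); rewrite ltNge normc_ge0.
have q1' : 0 < 1 - q by rewrite subr_gt0.
have tail : (fun n => M * q ^+ n / (1 - q)) @ \oo --> (0 : R).
  rewrite -[X in _ --> X](mul0r (1 - q)^-1); apply: cvgM; last exact: cvg_cst.
  by apply: cvg_geometric; rewrite ger0_norm.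
have /cvgrPdist_lt /(_ _ e0) : (fun n => M * q ^+ n / (1 - q)) @ \oo --> (0 : R) := tail.
apply: filterS => N; rewrite sub0r normrN ger0_norm; last first.
  by rewrite divr_ge0 ?mulr_ge0 ?exprn_ge0// ltW.
move=> Ne u Du; apply/ler_addgt0Pr => e' e'0.
have /cvgcP /(_ _ e'0) [K _ Kl] := geometric_cvg q01 (fun n => fM n u Du).
have := Kl (maxn K N) (leq_maxl _ _); set K' := maxn K N => KK.
rewrite -(subrK (series (fun n => f n u) K') (limn _)) -addrA.
apply: le_trans (normcD_le _ _) _; rewrite [leLHS]addrC; apply: lerD; last exact: ltW.
have -> : series (fun n => f n u) K' - \sum_(0 <= n < N) f n u =
    \sum_(N <= n < K') f n u.
  by rewrite /series/= (big_cat_nat (leq0n N) (leq_maxr K N))/= addrC addrK.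
apply: le_trans (normc_sum_le _ _ _) _; apply: le_trans (ltW Ne).
apply: le_trans (geometric_tail N K' q01 M0).
by apply: ler_sum => n _; exact: fM.
Qed.

End Weierstrass.

Section MittagLeffler.
Context {R : realType}.
Variables (la : R) (p : R[i]).
Hypothesis la_ge0 : 0 <= la.
Hypothesis p_lt4 : la = 0 -> `|p| < 4%:R.

Lemma Gamma_real_addr1 (x : R) : 0 <= x ->
  Gamma ((x + 1)%:C) = (real_gamma (x + 1))%:C :> R[i].
Proof. by move=> x0; rewrite GammaE ?eulerGamma_real//= ltr_wpDl. Qed.

(** Majorant of the Mittag-Leffler terms on the disc of radius [|p| / 4],
    which contains all the values [p u (1 - u)]. *)
Lemma mittag_leffler_majorant : exists M q : R, 0 <= q < 1 /\
  forall k, (normc p / 4) ^+ k / real_gamma (la * k%:R + 1) <= M * q ^+ k.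
Proof.
have p0 : 0 <= normc p := normc_ge0 p.
(* [K] is the left end of the interval kept in [real_gamma_lower_bound]. For
   [la = 0] the bound on [p] is what makes the ratio smaller than [1]; for
   positive [la] a large [K] does. *)
have [K [K0 Kq]] : exists K : R, 0 < K /\ normc p / 4 < K `^ la.
  have [la0|la0] := eqVneq la 0.
    exists 1; rewrite powR1 ltr01; split => //.
    have := p_lt4 la0; rewrite normrC -(natrC 4) ltcR => h.
    by rewrite ltr_pdivrMr// mul1r.
  exists ((normc p + 1) `^ la^-1).
  have p1 : 0 < normc p + 1 by rewrite ltr_wpDl.
  rewrite powR_gt0//; split => //.
  rewrite -powRrM mulVf// powRr1 ?(ltW p1)// ltr_pdivrMr//; lra.
have Kla : 0 < K `^ la by exact: powR_gt0.
have K1 : 0 < K + 1 by rewrite addr_gt0.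
pose c := K * expR (- (K + 1)) / (K + 1).
have c0 : 0 < c by rewrite divr_gt0// mulr_gt0// expR_gt0.
exists c^-1, (normc p / 4 / K `^ la).
rewrite divr_ge0 ?divr_ge0 ?(ltW Kla)//= ltr_pdivrMr// mul1r; split => // k.
have x0 : 0 < la * k%:R + 1 by rewrite ltr_wpDl// mulr_ge0.
have G0 := real_gamma_gt0 x0.
have h : (K `^ la) ^+ k * c <= real_gamma (la * k%:R + 1).
  apply: le_trans (real_gamma_lower_bound x0 K0).
  rewrite powRD ?(gt_eqF K0) ?implybT// (powRr1 (ltW K0)) powRrM.
  by rewrite (powR_mulrn _ (ltW Kla)) /c !mulrA.
apply: (@le_trans _ _ ((normc p / 4) ^+ k / ((K `^ la) ^+ k * c))).
  rewrite ler_wpM2l ?exprn_ge0 ?divr_ge0// lef_pV2 ?posrE//.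
  by rewrite mulr_gt0// exprn_gt0.
by rewrite [(normc p / 4 / _) ^+ k]expr_div_n invfM mulrA [leLHS]mulrC.
Qed.

Lemma quarter_bound (u : R) : 0 <= u <= 1 -> 0 <= u * (1 - u) <= 4^-1.
Proof.
move=> /andP[u0 u1]; rewrite mulr_ge0 ?subr_ge0//=.
by have := sqr_ge0 (u - 2^-1); rewrite expr2; lra.
Qed.

Lemma mittag_leffler_uniform_series :
  uniform_series (`]0, 1[%classic : set (measurableTypeR R))
    (fun k u => (p * u%:C * (1 - u%:C)) ^+ k / Gamma ((la * k%:R + 1)%:C))
    (fun u => mittag_leffler la (p * u%:C * (1 - u%:C))).
Proof.
have [M [q [q01 Mq]]] := mittag_leffler_majorant.
have ub k u : (`]0, 1[%classic : set R) u ->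
    normc ((p * u%:C * (1 - u%:C)) ^+ k / Gamma ((la * k%:R + 1)%:C)) <= M * q ^+ k.
  rewrite /= in_itv/= => /andP[u0 u1]; apply: le_trans (Mq k).
  have x0 : 0 < la * k%:R + 1 by rewrite ltr_wpDl// mulr_ge0.
  rewrite Gamma_real_addr1 ?mulr_ge0// normcM normcV normc_real gtr0_norm ?real_gamma_gt0//.
  rewrite ler_pM2r ?invr_gt0 ?real_gamma_gt0// normcX.
  have -> : p * u%:C * (1 - u%:C) = p * (u * (1 - u))%:C.
    by rewrite rmorphM rmorphB rmorph1 mulrA.
  have /andP[h0 h1] : 0 <= u * (1 - u) <= 4^-1 by apply: quarter_bound; rewrite !ltW.
  rewrite lerXn2r ?nnegrE ?normc_ge0 ?divr_ge0 ?normc_ge0//.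
  by rewrite normcM normc_real ger0_norm// ler_wpM2l ?normc_ge0.
apply: (@geometric_uniform_series _ _ M q) => // k; split; last first.
  by exists (M * q ^+ k) => u; exact: ub.
apply: cmeasurableM; last exact: cmeasurable_cst.
have mb : cmeasurable (`]0, 1[%classic : set (measurableTypeR R))
    (fun u => p * u%:C * (1 - u%:C)).
  apply: cmeasurableM.
    apply: cmeasurableM; first exact: cmeasurable_cst.
    by apply: cmeasurable_real; exact: measurable_id.
  apply: cmeasurableD; first exact: cmeasurable_cst.
  by apply: cmeasurableN; apply: cmeasurable_real; exact: measurable_id.
exact: cmeasurableX.
Qed.

End MittagLeffler.

(** * The principal logarithm on the right half-plane *)

Section HalfPlaneLogarithm.
Context {R : realType}.
Implicit Types (z w x : R[i]) (u : R).

Lemma carg_halfplane z : 0 < complex.Re z ->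
  carg z = atan (complex.Im z / complex.Re z).
Proof.
move=> z0; set t := complex.Im z / complex.Re z.
have zt : complex.Re z / normc z = cos (atan t).
  have -> : normc z = complex.Re z * Num.sqrt (1 + t ^+ 2).
    rewrite -[LHS](ger0_norm (normc_ge0 z)) -sqrtr_sqr normc_sqr.
    have -> : complex.Re z ^+ 2 + complex.Im z ^+ 2 = complex.Re z ^+ 2 * (1 + t ^+ 2).
      by rewrite /t; field; rewrite gt_eqF.
    by rewrite sqrtrM ?sqr_ge0// sqrtr_sqr gtr0_norm.
  by rewrite cos_atan invfM mulrA divff ?mul1r// gt_eqF.
have pi0 := pi_gt0 R; have t1 := atan_ltpi2 t; have t2 := atan_gtNpi2 t.
rewrite /carg Re_norm zt; case: ifPn => iz.
  have : 0 <= atan t by rewrite -[leLHS]atan0; apply: le_atan; rewrite divr_ge0// ltW.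
  by move=> t0; rewrite cosK// in_itv/= t0/=; lra.
have : atan t <= 0.
  rewrite -[leRHS]atan0; apply: le_atan.
  by rewrite /t mulr_le0_ge0 ?invr_ge0 ?(ltW z0)// ltW// ltNge.
by move=> t0; rewrite cosKN ?opprK// t0 andbT; lra.
Qed.

(** On the right half-plane the principal logarithm is given by a formula in
    [ln] and [atan] that can be differentiated termwise. *)
Definition halfplane_log z : R[i] :=
  (ln (complex.Re z ^+ 2 + complex.Im z ^+ 2) / 2) +i*
  atan (complex.Im z / complex.Re z).

Lemma cLog_halfplane z : 0 < complex.Re z -> cLog z = halfplane_log z.
Proof.
move=> z0; rewrite /cLog /halfplane_log carg_halfplane// Re_norm -normc_sqr.
have n0 : 0 < normc z by apply: lt_le_trans z0 (le_trans (ler_norm _) (normc_Re z)).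
by rewrite lnXn// -[_ *+ 2]mulr_natr mulfK.
Qed.

Lemma is_cderive_halfplane_log u (w : R -> R[i]) z :
  0 < complex.Re (w u) -> is_cderive u w z ->
  is_cderive u (fun v => halfplane_log (w v)) (z / w u).
Proof.
move=> w0 [wr wi].
set P := fun v => complex.Re (w v); set Q := fun v => complex.Im (w v).
have P0 : P u != 0 by rewrite gt_eqF.
have N0 : 0 < P u ^+ 2 + Q u ^+ 2.
  by rewrite ltr_pwDl ?sqr_ge0// exprn_gt0.
have dN : is_derive u 1 (fun v => P v ^+ 2 + Q v ^+ 2)
    (2 * (P u * complex.Re z + Q u * complex.Im z)).
  apply: (is_derive_eq (is_deriveD (is_deriveX 2 wr) (is_deriveX 2 wi))).
  by rewrite /GRing.scale /= -/(P u) -/(Q u) !expr1; ring.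
have dL : is_derive u 1 (fun v => ln (P v ^+ 2 + Q v ^+ 2) / 2)
    ((P u ^+ 2 + Q u ^+ 2)^-1 * (P u * complex.Re z + Q u * complex.Im z)).
  have h := is_deriveZ 2^-1 
    (@is_derive1_comp _ (@ln R) (fun v => P v ^+ 2 + Q v ^+ 2) u _ _
      (is_derive1_ln N0) dN).
  rewrite (_ : (fun v => _) = 2^-1 *: (@ln R \o (fun v => P v ^+ 2 + Q v ^+ 2))).
    by apply: (is_derive_eq h); rewrite /GRing.scale /=; field; rewrite gt_eqF.
  by apply/funext => v; rewrite mulrC.
have dA : is_derive u 1 (fun v => atan (Q v / P v))
    ((P u ^+ 2 + Q u ^+ 2)^-1 * (P u * complex.Im z - Q u * complex.Re z)).
  have h := @is_derive1_comp _ atan (fun v => Q v / P v) u _ _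
    (is_derive1_atan (Q u / P u))
    (is_deriveM wi (is_deriveV P0 wr)).
  apply: (is_derive_eq h); rewrite /GRing.scale /= -/(P u) -/(Q u).
  by field; rewrite P0 gt_eqF.
have wn0 : w u != 0 by apply: Re_neq0.
have zE : z / w u = ((P u ^+ 2 + Q u ^+ 2)^-1 * (P u * complex.Re z + Q u * complex.Im z)) +i*
   ((P u ^+ 2 + Q u ^+ 2)^-1 * (P u * complex.Im z - Q u * complex.Re z)).
  apply: (mulIf wn0); rewrite divfK//; apply: complex_ext.
    by rewrite Re_mul /= -/(P u) -/(Q u); field; rewrite gt_eqF.
  by rewrite Im_mul /= -/(P u) -/(Q u); field; rewrite gt_eqF.
by rewrite zE; split.
Qed.

End HalfPlaneLogarithm.

(** * Uniform convergence of the binomial series *)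

Section BinomialSeries.
Context {R : realType}.
Variables (alpha x : R[i]).
Hypothesis x_lt1 : normc x < 1.
Implicit Types u : R.

Definition binomial_coef (m : nat) : R[i] :=
  pochhammer alpha m * x ^+ m / m`!%:R.

Lemma binomial_coefS m :
  m.+1%:R * binomial_coef m.+1 = (alpha + m%:R) * x * binomial_coef m.
Proof.
rewrite /binomial_coef /pochhammer big_ord_recr/= exprS factS natrM.
have m0 : m.+1%:R != 0 :> R[i] by rewrite pnatr_eq0.
have f0 : m`!%:R != 0 :> R[i] by rewrite pnatr_eq0 -lt0n fact_gt0.
move: (\prod_(i < m) _) (x ^+ m) (m.+1%:R) m0 (m`!%:R) f0 => A B M m0 F f0.
by field; rewrite m0 f0.
Qed.

(** Controls, up to a constant factor, the derivative computed in
    [is_cderive_q_partial_sum]. *)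
Let weight m := m%:R * normc (binomial_coef m).

Lemma cvg_ratio (b : nat -> R) (rho : R) N0 : 0 <= rho < 1 ->
  (forall n, 0 <= b n) -> (forall n, (N0 <= n)%N -> b n.+1 <= rho * b n) ->
  b @ \oo --> (0 : R).
Proof.
move=> /andP[r0 r1] b0 br; rewrite -(cvg_shiftn N0).
have bk k : b (k + N0)%N <= b N0 * rho ^+ k.
  elim: k => [|k ih]; first by rewrite expr0 mulr1.
  rewrite addSn; apply: le_trans (br _ (leq_addl _ _)) _.
  by rewrite exprS mulrCA ler_wpM2l.
apply: (@squeeze_cvgr _ _ _ _ (fun=> 0) (fun k => b N0 * rho ^+ k)).
- by apply: nearW => k; rewrite b0 bk.
- exact: cvg_cst.
- by apply: cvg_geometric; rewrite ger0_norm.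
Qed.

(** The ratio of consecutive terms tends to [normc x], so it is eventually below
    the midpoint of [normc x] and [1]. *)
Lemma cvg_weight : weight @ \oo --> (0 : R).
Proof.
have x0 := normc_ge0 x.
have rho01 : 0 <= (1 + normc x) / 2 < 1.
  apply/andP; split; first by rewrite divr_ge0 ?addr_ge0.
  by rewrite ltr_pdivrMr// mul1r; have := x_lt1; lra.
(* From [n = K] on, [(normc alpha + n) * normc x] is at most
   [(1 + normc x) / 2 * n]. *)
pose K := normc alpha * normc x / ((1 - normc x) / 2).
apply: (@cvg_ratio _ _ (Num.truncn K).+1 rho01).
  by move=> n; rewrite mulr_ge0 ?normc_ge0.
move=> n Kn; have n0 : 0 < n%:R :> R by rewrite ltr0n (leq_trans _ Kn).
rewrite /weight -[X in X * _](normc_nat n.+1) -normcM binomial_coefS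
  (normcM (_ * x)) (normcM _ x) mulrA.
rewrite ler_wpM2r ?normc_ge0//.
apply: (@le_trans _ _ ((normc alpha + n%:R) * normc x)).
  by rewrite ler_wpM2r// (le_trans (normcD_le _ _))// normc_nat.
have Kn' : K <= n%:R.
  by apply: ltW; apply: lt_le_trans (truncnS_gt K) _; rewrite ler_nat.
have d0 : 0 < (1 - normc x) / 2 by rewrite divr_gt0// subr_gt0.
move: Kn'; rewrite ler_pdivrMr//; lra.
Qed.

Let w u : R[i] := 1 - x * u%:C.

Lemma binomial_base_gt0 u : 0 <= u <= 1 -> 1 - normc x <= complex.Re (w u).
Proof.
move=> /andP[u0 u1]; rewrite /w Re_add Re_opp Re_mul/= mulr0 subr0 lerD2l lerN2.
apply: le_trans (ler_norm _) _; rewrite normrM (ger0_norm u0).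
by rewrite -[leRHS]mulr1 ler_pM// normc_Re.
Qed.

Let w_gt0 u : 0 <= u <= 1 -> 0 < complex.Re (w u).
Proof. by move=> /binomial_base_gt0; apply: lt_le_trans; rewrite subr_gt0. Qed.

Let q (a : R[i]) u := cexp (a * halfplane_log (w u)).

Lemma binomial_power_bound (a : R[i]) : exists E : R,
  forall u, 0 <= u <= 1 -> normc (q a u) <= E.
Proof.
pose d := 1 - normc x; have d0 : 0 < d by rewrite subr_gt0.
exists (expR (normc a * (- ln d + ln 2 + pi))) => u u01.
rewrite /q normc_cexp ler_expR; apply: le_trans (ler_norm _) _.
apply: le_trans (normc_Re _) _; rewrite normcM ler_wpM2l ?normc_ge0//.
have wd := binomial_base_gt0 u01; have w0 := w_gt0 u01.
have wn : d <= normc (w u) by apply: le_trans wd (le_trans (ler_norm _) (normc_Re _)).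
have w2 : normc (w u) <= 2.
  apply: le_trans (normcD_le _ _) _; rewrite normcN normcM normc_real (normc_nat 1).
  have /andP[u0 u1] := u01; rewrite (ger0_norm u0).
  rewrite [leRHS](_ : 2 = 1 + 1 * 1); last by ring.
  by rewrite lerD2l ler_pM ?normc_ge0// ltW.
have wn0 : 0 < normc (w u) by exact: lt_le_trans wn.
have ld : ln d <= 0 by apply: ln_le0; rewrite gerBl normc_ge0.
have l2 : 0 <= ln 2 :> R by apply: ln_ge0; rewrite ler1n.
rewrite -(cLog_halfplane w0); apply: le_trans (normc_le_ReIm _) _.
apply: lerD; rewrite /cLog /= ?Re_norm.
  rewrite ler_norml; apply/andP; split.
    have : ln d <= ln (normc (w u)) by rewrite ler_ln ?posrE.
    by lra.
  have : ln (normc (w u)) <= ln 2 by rewrite ler_ln ?posrE.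
  by lra.
rewrite carg_halfplane// ler_norml.
have := atan_gtNpi2 (complex.Im (w u) / complex.Re (w u)).
have := atan_ltpi2 (complex.Im (w u) / complex.Re (w u)).
have := pi_gt0 R; move: (atan _) => t; lra.
Qed.

Lemma is_cderive_w u : is_cderive u w (- x).
Proof.
have d1 := is_cderive_real (is_derive_id u (1 : R)).
rewrite (_ : w = fun v => 1 + (- x) * v%:C); last first.
  by apply/funext => v; rewrite mulNr.
apply: (is_cderive_eq (is_cderiveD (is_cderive_cst u 1) (is_cderiveZ (- x) d1))).
by rewrite add0r rmorph1 mulr1.
Qed.

Lemma is_cderive_q a u : 0 <= u <= 1 -> is_cderive u (q a) (- a * x / w u * q a u).
Proof.
move=> u01.
have dl := is_cderive_halfplane_log (w_gt0 u01) (is_cderive_w u).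
apply: (is_cderive_eq (is_cderive_cexp (is_cderiveZ a dl))).
by rewrite /q; congr (_ * _); rewrite mulrA mulrN -mulNr.
Qed.

Let P N u : R[i] := \sum_(0 <= m < N) binomial_coef m * (u ^+ m)%:C.

(** By the recurrence [binomial_coefS] the partial sums solve the differential
    equation of [(1 - x u) ^ (- alpha)] up to their last term, so in the
    derivative of their product with [(1 - x u) ^ alpha] everything else
    telescopes. *)
Lemma is_cderive_q_partial_sum N u : 0 <= u <= 1 ->
  is_cderive u (fun v => q alpha v * P N v)
   (- (q alpha u / w u * (N%:R * binomial_coef N * (u ^+ N.-1)%:C))).
Proof.
move=> u01.
have dP : is_cderive u (P N) (\sum_(0 <= m < N) binomial_coef m * (m%:R * (u ^+ m.-1)%:C)).
  apply: is_cderive_sum => m; apply: is_cderiveZ.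
  have dX : is_derive u 1 (fun v : R => v ^+ m) (m%:R * u ^+ m.-1).
    have := is_deriveX m (is_derive_id u (1 : R)).
    by rewrite exprfctE /GRing.scale /= mulr1.
  apply: (is_cderive_eq (is_cderive_real dX)).
  by rewrite rmorphM rmorph_nat.
apply: (is_cderive_eq (is_cderiveM (is_cderive_q alpha u01) dP)).
have wn0 : w u != 0 by apply: Re_neq0; exact: w_gt0.
pose d m := m%:R * binomial_coef m * (u ^+ m.-1)%:C.
have tel : w u * (\sum_(0 <= m < N) binomial_coef m * (m%:R * (u ^+ m.-1)%:C)) -
    alpha * x * P N u = - d N.
  rewrite /P !big_distrr/= -sumrB.
  rewrite (telescope_sumr_eq (fun m => - d m))//.
    by rewrite /d mul0r mul0r oppr0 subr0.
  move=> m _; rewrite opprK /d /w [in RHS]binomial_coefS /=.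
  have : m%:R * (u ^+ m)%:C = m%:R * (u%:C * (u ^+ m.-1)%:C) :> R[i].
    by case: m => [|m]; rewrite ?mul0r// exprS rmorphM.
  move: (binomial_coef m) (u ^+ m)%:C (u ^+ m.-1)%:C m%:R => A U V M MU.
  transitivity (M * A * V - (x * A * (M * (u%:C * V))) - alpha * x * A * U); first by ring.
  by rewrite -MU; ring.
set S := (\sum_(0 <= m < N) binomial_coef m * _) in tel *.
transitivity (q alpha u / w u * (w u * S - alpha * x * P N u)).
  clear tel; move: (P N u) S (q _ u) (w u) wn0 => A B C W W0.
  by field.
by rewrite tel mulrN.
Qed.

(** The product is [1] at [u = 0] and its derivative is at most a constant times
    [weight N]. *)
Lemma q_partial_sum_dist : exists B : R, 0 <= B /\
  forall N u, (0 < N)%N -> 0 <= u <= 1 ->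
  normc (q alpha u * P N u - 1) <= B * weight N.
Proof.
have [E qE] := binomial_power_bound alpha.
have d0 : 0 < 1 - normc x by rewrite subr_gt0.
have i0 : 0 <= (0 : R) <= 1 by rewrite lexx ler01.
have E0 : 0 <= E := le_trans (normc_ge0 _) (qE 0 i0).
exists (2 * (E / (1 - normc x))); split; first by rewrite mulr_ge0// divr_ge0// ltW.
move=> N u N0 /andP[u0 u1].
have start : q alpha 0 * P N 0 = 1.
  have w0 : w 0 = 1 by rewrite /w mulr0 subr0.
  rewrite /q w0 /halfplane_log /= expr1n expr0n/= addr0 ln1 !mul0r atan0.
  rewrite (_ : alpha * _ = 0); last by rewrite -[RHS](mulr0 alpha).
  rewrite cexp0 mul1r /P big_ltn// big1_seq ?addr0; last first.
    by move=> m /andP[_]; rewrite mem_index_iota => /andP[m0 _]; rewrite expr0n gtn_eqF// mulr0.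
  by rewrite /binomial_coef /pochhammer big_ord0 !expr0 !mulr1 divr1.
rewrite -start; pose M := E / (1 - normc x) * weight N.
have W0 : 0 <= weight N by rewrite mulr_ge0 ?normc_ge0.
have M0 : 0 <= M by rewrite mulr_ge0// divr_ge0// ltW.
have sub1 v : 0 <= v <= u -> 0 <= v <= 1.
  by move=> /andP[-> vu]; exact: le_trans vu u1.
apply: le_trans (cderive_dist_le (M := M) u0
  (fun v vu => is_cderive_q_partial_sum N (sub1 v vu)) _) _; last first.
  by rewrite -mulrA ler_wpM2l// subr0 -[leRHS]mulr1 ler_wpM2l.
move=> v /sub1 v01; rewrite normcN (normcM (_ / _)) (normcM (q _ _)) normcV.
have vN : v ^+ N.-1 <= 1 by apply: exprn_ile1; case/andP: v01.
have v0 : 0 <= v ^+ N.-1 by apply: exprn_ge0; case/andP: v01.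
have wd : 1 - normc x <= normc (w v).
  by apply: le_trans (binomial_base_gt0 v01) (le_trans (ler_norm _) (normc_Re _)).
rewrite /M (normcM (_ * _)) (normcM N%:R) normc_nat normc_real (ger0_norm v0).
apply: ler_pM.
- by rewrite divr_ge0 ?normc_ge0.
- by rewrite !mulr_ge0 ?normc_ge0.
- apply: ler_pM; rewrite ?invr_ge0 ?normc_ge0 ?qE//.
  by rewrite lef_pV2 ?posrE// (lt_le_trans d0).
- by rewrite -[leRHS]mulr1 ler_wpM2l.
Qed.

(** The difference with the partial sum is [(1 - x u) ^ (- alpha)] times the
    distance to [1] of [(1 - x u) ^ alpha] times the partial sum. *)
Lemma binomial_uniform_series :
  uniform_series (`]0, 1[%classic : set (measurableTypeR R))
    (fun m u => binomial_coef m * (u ^+ m)%:C)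
    (fun u => cpow (1 - x * u%:C) (- alpha)).
Proof.
split=> [m|e e0].
  split.
    apply: cmeasurableM; first exact: cmeasurable_cst.
    by apply: cmeasurable_real; apply: measurable_funX; exact: measurable_id.
  exists (normc (binomial_coef m)) => u; rewrite /= in_itv/= => /andP[u0 u1].
  rewrite normcM normc_real ger0_norm ?exprn_ge0 ?(ltW u0)//.
  rewrite -[leRHS]mulr1 ler_wpM2l ?normc_ge0// exprn_ile1// ltW//.
have [E qE] := binomial_power_bound (- alpha).
have [B [B0 qB]] := q_partial_sum_dist.
have i0 : 0 <= (0 : R) <= 1 by rewrite lexx ler01.
have E0 : 0 <= E := le_trans (normc_ge0 _) (qE 0 i0).
have EB : (fun n => E * B * weight n) @ \oo --> (0 : R).
  by rewrite -(mulr0 (E * B)); apply: cvgMr; exact: cvg_weight.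
have /cvgrPdist_lt /(_ _ e0) EBe := EB.
near=> N => u; rewrite /= in_itv/= => /andP[u0 u1].
have u01 : 0 <= u <= 1 by rewrite !ltW.
have N0 : (0 < N)%N by near: N; exact: nbhs_infty_gt.
have w0 : w u != 0 by apply: Re_neq0; exact: w_gt0.
have -> : cpow (1 - x * u%:C) (- alpha) = q (- alpha) u.
  by rewrite /cpow -/(w u) (negbTE w0) (cLog_halfplane (w_gt0 u01)).
have -> : q (- alpha) u - \sum_(0 <= m < N) binomial_coef m * (u ^+ m)%:C =
    q (- alpha) u * (1 - q alpha u * P N u).
  rewrite mulrBr mulr1 mulrA -cexpD -mulrDl addNr mul0r cexp0 mul1r.
  by [].
rewrite normcM distcC.
apply: (@le_trans _ _ (E * (B * weight N))).
  by apply: ler_pM; rewrite ?normc_ge0 ?qE ?qB.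
have : `|0 - E * B * weight N| < e by near: N.
rewrite sub0r normrN mulrA => /ltW; apply: le_trans; exact: ler_norm.
Unshelve. all: by end_near. Qed.

End BinomialSeries.

(** * Beta integrals on the unit interval and the Wright series *)

Section Assembly.
Context {R : realType}.
Local Notation mu := (@lebesgue_measure R).
Local Notation D := (`]0, 1[%classic : set (measurableTypeR R)).
Implicit Types (a b : R[i]) (u : R).

Lemma uniform_cvg_normc (f : nat -> R -> R[i]) (l : R -> R[i]) (A : set R) :
  {uniform A, f @ \oo --> l} ->
  forall e, 0 < e -> \forall N \near \oo, forall u, A u -> normc (l u - f N u) <= e.
Proof.
move=> fl e e0; have e0C : 0 < e%:C :> R[i] by rewrite ltcR.
have := fl [set h | forall u, A u -> normc (l u - h u) <= e]; apply.
apply/uniform_nbhs; exists [set z : R[i] * R[i] | ball z.1 e%:C z.2]; split.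
  exact: (entourage_ball _ (PosNum e0C)).
move=> h /= hl u Au; have := hl u Au; rewrite -ball_normE /= ltcR.
exact: ltW.
Qed.

Lemma mem_unit_itv u : D u -> 0 < u /\ 0 < 1 - u.
Proof. by rewrite /= in_itv/= subr_gt0 => /andP[]. Qed.

Lemma real_onem u : 1 - u%:C = (1 - u)%:C :> R[i].
Proof. by rewrite rmorphB rmorph1. Qed.

Lemma beta_density_patch a b : beta_density a b =
  (fun u => cpow u%:C (a - 1) * cpow (1 - u%:C) (b - 1)) \_ D.
Proof.
apply/funext => u; rewrite patchE; case: ifPn => [/set_mem/mem_unit_itv[u0 u1]|].
  by rewrite /beta_density (halfline_pow_gt0 a u0) (halfline_pow_gt0 b u1) real_onem.
rewrite notin_setE/= in_itv/= => /negP; rewrite negb_and -!leNgt /beta_density.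
move=> /orP[u0|u1]; first by rewrite (halfline_pow_le0 a u0) mul0r.
have u1' : 1 - u <= 0 by rewrite subr_le0.
by rewrite (halfline_pow_le0 b u1') mulr0.
Qed.

Lemma cintegrable_patch (A : set (measurableTypeR R)) (f : R -> R[i]) :
  measurable A -> cintegrable setT (f \_ A) -> cintegrable A f.
Proof.
move=> mA [fr fi]; split; apply/(integrable_mkcond _ mA).
  by apply: (eq_integrable _ _ _ _ fr) => // u _; rewrite /= !patchE; case: ifPn.
by apply: (eq_integrable _ _ _ _ fi) => // u _; rewrite /= !patchE; case: ifPn.
Qed.

Lemma cintegrable_beta a b : 0 < complex.Re a -> 0 < complex.Re b ->
  cintegrable D (fun u => cpow u%:C (a - 1) * cpow (1 - u%:C) (b - 1)).
Proof.
move=> a0 b0; apply: cintegrable_patch; first exact: measurable_itv.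
by rewrite -beta_density_patch; exact: cintegrable_beta_density.
Qed.

(** Dividing by [Gamma (a + b)] is legitimate because Gamma has no zero on the
    right half-plane. *)
Lemma cintegral_beta a b : 0 < complex.Re a -> 0 < complex.Re b ->
  cintegral D (fun u => cpow u%:C (a - 1) * cpow (1 - u%:C) (b - 1)) =
  Gamma a * Gamma b / Gamma (a + b).
Proof.
move=> a0 b0; have ab0 : 0 < complex.Re (a + b) by rewrite Re_add addr_gt0.
rewrite !GammaE// Beta_Gamma// -cintegral_patch -beta_density_patch.
by rewrite mulrAC divff ?mul1r// eulerGamma_neq0.
Qed.

Lemma cpow_beta_shift a b k u : D u ->
  cpow u%:C (a - 1) * cpow (1 - u%:C) (b - 1) * (u%:C * (1 - u%:C)) ^+ k =
  cpow u%:C (a + k%:R - 1) * cpow (1 - u%:C) (b + k%:R - 1).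
Proof.
move=> /mem_unit_itv[u0 u1]; rewrite real_onem.
rewrite !(addrAC _ k%:R) (cpow_realD (a - 1) _ u0) (cpow_realD (b - 1) _ u1).
rewrite !cpow_real_nat// exprMn !rmorphXn.
by rewrite mulrACA.
Qed.

(** Integrating the Mittag-Leffler series termwise produces the Wright series,
    each term being a Beta integral. *)
Lemma wright_series_cvg (la : R) (p a b : R[i]) : 0 <= la ->
  (la = 0 -> `|p| < 4%:R) -> 0 < complex.Re a -> 0 < complex.Re b ->
  wright_series [:: (a, 1); (b, 1); (1, 1)] [:: (a + b, 2%:R); (1, la)] p @ \oo -->
  cintegral D (fun u => cpow u%:C (a - 1) * cpow (1 - u%:C) (b - 1) *
    mittag_leffler la (p * u%:C * (1 - u%:C))).
Proof.
move=> la0 p4 a0 b0; have mD : measurable D by exact: measurable_itv.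
have T := cintegral_uniform_series mD (cintegrable_beta a0 b0)
  (mittag_leffler_uniform_series la0 p4).
suff -> : wright_series [:: (a, 1); (b, 1); (1, 1)] [:: (a + b, 2%:R); (1, la)] p =
    series (fun k => cintegral D (fun u =>
      cpow u%:C (a - 1) * cpow (1 - u%:C) (b - 1) *
      ((p * u%:C * (1 - u%:C)) ^+ k / Gamma (la * k%:R + 1)%:C))) by exact: T.
congr series; apply/funext => k.
have ak : 0 < complex.Re (a + k%:R) by rewrite Re_add -natrC ltr_wpDr.
have bk : 0 < complex.Re (b + k%:R) by rewrite Re_add -natrC ltr_wpDr.
have kE : (1 * k%:R)%:C = k%:R :> R[i] by rewrite mul1r rmorph_nat.
have k2E : a + b + (2%:R * k%:R)%:C = (a + k%:R) + (b + k%:R).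
  by rewrite rmorphM !rmorph_nat; ring.
have laE : 1 + (la * k%:R)%:C = (la * k%:R + 1)%:C.
  by rewrite rmorphD rmorph1 addrC.
have GE : Gamma (1 + k%:R) = k`!%:R :> R[i].
  by rewrite GammaE ?eulerGamma_nat// Re_add -natrC /= ltr_wpDr.
rewrite !big_cons !big_nil !mulr1 /fst /snd kE k2E laE GE.
have -> : cintegral D (fun u => cpow u%:C (a - 1) * cpow (1 - u%:C) (b - 1) *
      ((p * u%:C * (1 - u%:C)) ^+ k / Gamma (la * k%:R + 1)%:C)) =
    p ^+ k / Gamma (la * k%:R + 1)%:C *
    (Gamma (a + k%:R) * Gamma (b + k%:R) / Gamma (a + k%:R + (b + k%:R))).
  rewrite -(cintegral_beta ak bk) -(cintegralZ mD _ (cintegrable_beta ak bk)).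
  apply: eq_cintegral => u Du; rewrite -(cpow_beta_shift a b k Du).
  rewrite -(mulrA p) exprMn.
  move: (cpow u%:C _) (cpow (1 - _) _) (p ^+ k) (Gamma _)^-1 ((_ * _) ^+ k).
  by move=> A B P G E; ring.
have f0 : k`!%:R != 0 :> R[i] by rewrite pnatr_eq0 -lt0n fact_gt0.
rewrite invfM.
move: (Gamma (a + _)) (Gamma (b + _)) (Gamma _)^-1 (Gamma _)^-1 => A B E G.
move: (p ^+ k) (k`!%:R) f0 => P F F0.
by field.
Qed.

End Assembly.

(** * The integral formula *)

Theorem theorem6 (R : realType) (c : nat -> R[i]) (g : nat -> R[i] -> R[i])
    (delta omega : R) (x t : R[i]) (j : nat) (alpha xs : 'I_j -> R[i])
    (r s : R[i]) (la : R) (p : R[i])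
    (delta_gt0 : 0 < delta) (omega_gt0 : 0 < omega)
    (Gcvg : {uniform `]0, 1[,
       (fun (N : nat) (u : R) => \sum_(0 <= n < N)
          c n * g n x * t ^+ n *
          (u `^ (delta * n%:R) * (1 - u) `^ (omega * n%:R))%:C) @ \oo
       --> (fun u : R => genfun c g x (t * (u `^ delta * (1 - u) `^ omega)%:C))})
    (j_ge1 : (1 <= j)%N)
    (xs_lt1 : forall i, `|xs i| < 1)
    (r_gt0 : 0 < complex.Re r) (s_gtr : complex.Re r < complex.Re s)
    (la_ge0 : 0 <= la)
    (p_lt4 : la = 0 -> `|p| < 4%:R) :
  let integrand := fun u : R =>
    cpow u%:C (r - 1) * cpow (1 - u%:C) (s - r - 1) *
    (\prod_(i < j) cpow (1 - xs i * u%:C) (- alpha i)) *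
    genfun c g x (t * (u `^ delta * (1 - u) `^ omega)%:C) *
    mittag_leffler la (p * u%:C * (1 - u%:C)) in
  let num (n M : nat) : seq (R[i] * R) :=
    [:: (r + (delta * n%:R)%:C + M%:R, 1);
        (s - r + (omega * n%:R)%:C, 1);
        (1, 1)] in
  let den (n M : nat) : seq (R[i] * R) :=
    [:: (s + (delta * n%:R)%:C + (omega * n%:R)%:C + M%:R, 2%:R);
        (1, la)] in
  [/\ cintegrable `]0, 1[ integrand,
      forall n M : nat, cvgn (wright_series (num n M) (den n M) p)
    & iterated_sum
        (fun v : j.+1.-tuple nat =>
           let n := thead v in
           let m (i : 'I_j) := tnth v (lift ord0 i) in
           c n * g n x * t ^+ n *
           (\prod_(i < j)
              (pochhammer (alpha i) (m i) * xs i ^+ m i / (m i)`!%:R)) *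
           wright (num n (\sum_(i < j) m i)%N) (den n (\sum_(i < j) m i)%N) p)
        (cintegral `]0, 1[ integrand)].
Proof.
move=> integrand num den.
pose D : set (measurableTypeR R) := `]0, 1[%classic.
have mD : measurable D by exact: measurable_itv.
have sr_gt0 : 0 < complex.Re (s - r) by rewrite Re_add Re_opp subr_gt0.
have a_gt0 n M : 0 < complex.Re (r + (delta * n%:R)%:C + M%:R).
  rewrite !Re_add -natrC /= ltr_wpDr// ltr_wpDr// mulr_ge0// ltW//.
have b_gt0 n : 0 < complex.Re (s - r + (omega * n%:R)%:C).
  by rewrite Re_add /= ltr_wpDr// mulr_ge0// ltW.
have denE n M : den n M = [:: (r + (delta * n%:R)%:C + M%:R +
    (s - r + (omega * n%:R)%:C), 2%:R); (1, la)].
  by rewrite /den; congr [:: (_, _); _]; ring.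
have wc n M := wright_series_cvg la_ge0 p_lt4 (a_gt0 n M) (b_gt0 n).
pose ML u := mittag_leffler la (p * u%:C * (1 - u%:C)).
have usML := mittag_leffler_uniform_series la_ge0 p_lt4.
pose h u := cpow u%:C (r - 1) * cpow (1 - u%:C) (s - r - 1) * ML u.
have ih : cintegrable D h.
  apply: cintegrableM => //; first exact: cintegrable_beta.
  exact: uniform_series_cbm usML.
pose W n u := u `^ (delta * n%:R) * (1 - u) `^ (omega * n%:R).
(* Index [0] carries the generating function, the others the binomial series;
   this is the order of summation. *)
pose f (i : 'I_j.+1) (n : nat) (u : R) : R[i] :=
  if unlift ord0 i is Some i' then binomial_coef (alpha i') (xs i') n * (u ^+ n)%:C
  else c n * g n x * t ^+ n * (W n u)%:C.
pose F (i : 'I_j.+1) (u : R) : R[i] :=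
  if unlift ord0 i is Some i' then cpow (1 - xs i' * u%:C) (- alpha i')
  else genfun c g x (t * (u `^ delta * (1 - u) `^ omega)%:C).
have usF i : uniform_series D (f i) (F i).
  rewrite /f /F; case: unliftP => [i' _|_].
    by apply: binomial_uniform_series; rewrite -ltcR -normrC.
  split; last first.
    move=> e e0; exact: (uniform_cvg_normc Gcvg e0).
  move=> n; split.
    apply: cmeasurableM; first exact: cmeasurable_cst.
    apply: cmeasurable_real; apply: measurable_funM.
      by apply: measurable_funTS; exact: measurable_powR.
    apply: (measurableT_comp (measurable_powR _)).
    by apply: measurable_funB; [exact: measurable_cst|exact: measurable_id].
  exists (normc (c n * g n x * t ^+ n)) => u Du.
  have [u0 u1] := mem_unit_itv Du.
  have le1 (y e : R) : 0 < y -> y <= 1 -> 0 <= e -> y `^ e <= 1.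
    move=> y0 y1 e0; rewrite -[leRHS](powRr0 y); apply: ger_powR => //.
    by rewrite y0.
  rewrite normcM normc_real ger0_norm ?mulr_ge0 ?powR_ge0//.
  rewrite -[leRHS]mulr1 ler_wpM2l ?normc_ge0//.
  rewrite mulr_ile1 ?powR_ge0// le1// ?mulr_ge0 ?(ltW delta_gt0) ?(ltW omega_gt0)//.
    by rewrite -subr_ge0 ltW.
  by rewrite gerBl ltW.
have prodF u : integrand u = h u * \prod_(i < j.+1) F i u.
  rewrite big_ord_recl /F unlift_none /integrand /h /ML.
  have -> : \prod_(i < j) (if unlift ord0 (lift ord0 i) is Some i' then
      cpow (1 - xs i' * u%:C) (- alpha i') else
      genfun c g x (t * (u `^ delta * (1 - u) `^ omega)%:C)) =
      \prod_(i < j) cpow (1 - xs i * u%:C) (- alpha i).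
    by apply: eq_bigr => i _; rewrite liftK.
  move: (\prod_(i < j) _) (genfun _ _ _ _) (mittag_leffler _ _) (cpow _ _) (cpow _ _).
  by move=> *; ring.
split.
- have prod_cbm : cbounded_measurable D (fun u => \prod_(i < j.+1) F i u).
    by apply: cbm_prod => i; exact: uniform_series_cbm (usF i).
  apply: (eq_cintegrable mD (f := fun u => h u * \prod_(i < j.+1) F i u)).
    by move=> u _; rewrite prodF.
  exact: cintegrableM.
- move=> n M; rewrite denE; apply/cvg_ex; eexists; exact: (wc n M).
- have := iterated_sum_cintegral mD ih usF.
  rewrite (_ : cintegral D _ = cintegral D integrand); last first.
    by apply: eq_cintegral => u _; rewrite prodF.
  congr (iterated_sum _ _); apply/funext => v.
  set n := thead v; set M := (\sum_(i < j) tnth v (lift ord0 i))%N.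
  rewrite /wright denE (limc_unique (wc n M)).
  set A := \prod_(i < j) _.
  rewrite -(cintegralZ mD); last first.
    apply: (cintegrableM mD (cintegrable_beta (a_gt0 n M) (b_gt0 n))).
    exact: uniform_series_cbm usML.
  apply: eq_cintegral => u Du; have [u0 u1] := mem_unit_itv Du.
  rewrite big_ord_recl /f unlift_none.
  have -> : \prod_(i < j) (if unlift ord0 (lift ord0 i) is Some i' then
      binomial_coef (alpha i') (xs i') (tnth v (lift ord0 i)) *
        (u ^+ tnth v (lift ord0 i))%:C
      else c (tnth v (lift ord0 i)) * g (tnth v (lift ord0 i)) x *
        t ^+ tnth v (lift ord0 i) * (W (tnth v (lift ord0 i)) u)%:C) =
      A * (u ^+ M)%:C.
    rewrite /A /M -prodrXr rmorph_prod -big_split /=.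
    by apply: eq_bigr => i _; rewrite liftK.
  have uE : cpow u%:C (r + (delta * n%:R)%:C + M%:R - 1) =
      cpow u%:C (r - 1) * (u `^ (delta * n%:R))%:C * (u ^+ M)%:C.
    rewrite -(cpow_real_powR _ u0) -(cpow_real_nat _ u0) -!(cpow_realD _ _ u0).
    by congr (cpow _ _); ring.
  have vE : cpow (1 - u)%:C (s - r + (omega * n%:R)%:C - 1) =
      cpow (1 - u)%:C (s - r - 1) * ((1 - u) `^ (omega * n%:R))%:C.
    rewrite -(cpow_real_powR _ u1) -(cpow_realD _ _ u1).
    by congr (cpow _ _); ring.
  have WE : (W n u)%:C =
      (u `^ (delta * n%:R))%:C * ((1 - u) `^ (omega * n%:R))%:C by rewrite /W rmorphM.
  rewrite -[tnth v ord0]/n /h /ML WE real_onem uE vE.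
  move: (mittag_leffler _ _) (cpow u%:C _) (cpow (1 - u)%:C _) A (u ^+ M)%:C.
  move: (_ `^ _)%:C ((1 - u) `^ _)%:C => U V ML' P Q A' X.
  by ring.
Qed.
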